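(* Let $(X,d,\nu)$ be a computable metric space. Suppose $X$ is $\delta_{\text{cover}}$-computable (in particular compact) and that the operation $$E:\subseteq\mathcal{A}(X)\rightrightarrows C(X,X),\quad A\mapsto\{f : \operatorname{im}f=A\wedge f|_A=\mathrm{id}_A\},\qquad\operatorname{dom}E=\mathcal{A}(X)\setminus\{\emptyset\},$$ is well-defined (i.e. $E(A)\neq\emptyset$ for every nonempty closed $A\subseteq X$) and computable, where the class $\mathcal{A}(X)$ of closed subsets of $X$ is represented by $\delta_{\text{range}}\sqcap\delta_{\text{dist}}^{>}$ and $C(X,X)$ by $[\delta_X\to\delta_X]$. Then $X$ is zero-dimensional and the operation $M:\subseteq X\times\Sigma^0_1(X)\rightrightarrows\Delta^0_1(X)$ with $\operatorname{dom}M=\{(x,U) : x\in U\}$ and $M(x,U)=\{W\in\Delta^0_1(X) : x\in W\subseteq U\}$ is computable.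
   Context: TTE conventions. $\mathbb{B}=\mathbb{N}^{\mathbb{N}}$, $p_i:=p(i)$. $\langle\cdot\rangle:\mathbb{N}^*\to\mathbb{N}$ (words) and $\langle\cdot,\cdot\rangle:\mathbb{N}^2\to\mathbb{N}$ (pairs) are standard computable tupling bijections. On $\mathbb{B}$: $\langle p^{(0)},p^{(1)}\rangle(2i+z)=p^{(z)}_i$ ($z\in\{0,1\}$) and $\langle p^{(0)},p^{(1)},\dots\rangle(\langle i,j\rangle)=p^{(i)}_j$. A representation of a set is a partial surjection $\delta:\subseteq\mathbb{B}\to X$; a point is $\delta$-computable if it has a computable $\delta$-name. A multi-valued operation $f:\subseteq X\rightrightarrows Y$ assigns to each $x\in\operatorname{dom}f$ a subset $f(x)\subseteq Y$; a $(\delta,\delta')$-realiser of $f$ is $F:\subseteq\mathbb{B}\to\mathbb{B}$ such that whenever $p\in\operatorname{dom}\delta$ and $\delta(p)\in\operatorname{dom}f$, $F(p)$ is defined, $F(p)\in\operatorname{dom}\delta'$ and $\delta'(F(p))\in f(\delta(p))$; $f$ is computable if it has a (Type-2 Turing machine) computable realiser. $[\delta_1,\delta_2]\langle p,q\rangle=(\delta_1(p),\delta_2(q))$ represents products. $\delta\sqcap\delta'$: $\langle p,q\rangle$ is a name of $x$ iff $\delta(p)=x=\delta'(q)$. $\eta$ is a standard representation (satisfying utm and smn theorems) of the continuous partial functions $\subseteq\mathbb{B}\to\mathbb{B}$ with $G_\delta$ domain, $\eta_p=\eta(p)$; $[\delta\to\delta']$: $p$ is a name of $f$ iff $\eta_p$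 is a $(\delta,\delta')$-realiser of the total map $f$. Computable metric space $(X,d,\nu)$: $(X,d)$ is a metric space, $\nu:\mathbb{N}\to X$ is total with dense image, and $(i,j)\mapsto d(\nu(i),\nu(j))$ is a computable double sequence of reals. $X$ carries the Cauchy representation $\delta_X$: $p$ is a name of $x$ iff $\lim_i\nu(p_i)=x$ and $d(\nu(p_i),\nu(p_j))<2^{-\min\{i,j\}}$ for all $i,j$. With $\nu_{\mathbb{Q}^+}$ a standard total numbering of the positive rationals, $\alpha\langle a,r\rangle=B_d(\nu(a);\nu_{\mathbb{Q}^+}(r))$. $\Sigma^0_1(X)$ (open sets) carries $\delta_{\Sigma^0_1}(p)=\bigcup\{\alpha(p_i-1) : p_i\geq1\}$; $\delta_{\Pi^0_1}(p)=X\setminus\delta_{\Sigma^0_1}(p)$; $\Delta^0_1(X)$ (clopen sets) carries $\delta_{\Delta^0_1}\langle p,q\rangle=W$ whenever $W=\delta_{\Sigma^0_1}(p)=\delta_{\Pi^0_1}(q)$. $\delta_{\text{cover}}$: $p$ is a name of compact $K\subseteq X$ iff $\{p_i : i\in\mathbb{N}\}=\{\langle w\rangle : w\in\mathbb{N}^*,K\subseteq\bigcup_{i<|w|}\alpha(w_i)\}$. $\delta_{\text{range}}$: $\langle p^{(0)},p^{(1)},\dots\rangle$ is a name of closed $A$ iff either $A=\emptyset$ and $p^{(i)}=0^{\omega}$ for all $i$, or $A\neq\emptyset$, all entries of all $p^{(i)}$ are $\geq1$, and, with $P(p)_i:=p_i-1$, each $P(p^{(i)})$ is a $\delta_X$-name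 of a point of $A$ and the points $\delta_X(P(p^{(i)}))$, $i\in\mathbb{N}$, are dense in $A$. $\delta_{\text{dist}}^{>}$: $p$ is a name of closed $A$ iff $\eta_p$ is a $(\delta_X,\overline{\rho_{<}})$-realiser of $d_A:X\to\overline{\mathbb{R}}$, $d_A(x)=\inf_{a\in A}d(x,a)$ ($\inf\emptyset=\infty$), where $p$ is a $\overline{\rho_{<}}$-name of $t\in\overline{\mathbb{R}}$ iff $\{n\in\mathbb{N} : \nu_{\mathbb{Q}}(n)<t\}=\{p_i-1 : i\in\mathbb{N},p_i\geq1\}$, $\nu_{\mathbb{Q}}$ a standard numbering of $\mathbb{Q}$. Zero-dimensional: a nonempty separable metrizable space is zero-dimensional if it has a basis of clopen sets. *)

(* Defs.v *)
From Stdlib Require Cantor.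
From mathcomp Require Import all_boot all_order all_algebra.
From mathcomp Require Import all_classical all_reals all_analysis.

Set Implicit Arguments.
Unset Strict Implicit.
Unset Printing Implicit Defensive.
Import Order.TTheory GRing.Theory Num.Theory.
Import numFieldNormedType.Exports.
Local Open Scope classical_set_scope.
Local Open Scope nat_scope.

Definition baire := nat -> nat.

Definition cpair (i j : nat) : nat := Cantor.to_nat (i, j).
Definition cfst (n : nat) : nat := (Cantor.of_nat n).1.
Definition csnd (n : nat) : nat := (Cantor.of_nat n).2.

Definition wcode (w : seq nat) : nat := CodeSeq.code w.

(* The tuplings <p0, p1> (2i + z) = pz i and <p0, p1, ...> <i, j> = pi j are
   bijections onto Baire space; they are used through their inverses:
   [bproj z] (for z = 0, 1) and [bcomp i] recover the components. *)
Definition bproj (z : nat) (r : baire) : baire := fun i => r (i.*2 + z).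
Definition bcomp (i : nat) (r : baire) : baire := fun j => r (cpair i j).

(* Programs for the partial recursive functions on nat relative to an oracle in
   Baire space. Arguments are packed with [cpair]; [Rec] is primitive recursion
   and [Mu] is unbounded minimisation. *)
Inductive prog : Type :=
  | Zero | Succ | Fst | Snd | Oracle
  | Comp of prog & prog
  | Pair of prog & prog
  | Rec of prog & prog
  | Mu of prog.

(* [eval p c n m]: with oracle p, program c halts on input n with output m. *)
Fixpoint eval (p : baire) (c : prog) (n m : nat) : Prop :=
  match c with
  | Zero => m = 0
  | Succ => m = n.+1
  | Fst => m = cfst n
  | Snd => m = csnd n
  | Oracle => m = p n
  | Comp c1 c2 => exists k, eval p c2 n k /\ eval p c1 k m
  | Pair c1 c2 => exists i j, [/\ eval p c1 n i, eval p c2 n j & m = cpair i j]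
  | Rec c1 c2 => exists v : nat -> nat,
      [/\ eval p c1 (cfst n) (v 0),
          forall i, i < csnd n -> eval p c2 (cpair (cfst n) (cpair i (v i))) (v i.+1)
        & m = v (csnd n)]
  | Mu c1 => eval p c1 (cpair n m) 0 /\
      forall i, i < m -> exists k, eval p c1 (cpair n i) k.+1
  end.

(* The oracle 0^omega is computable, hence contributes nothing. *)
Definition computable_point (p : baire) : Prop :=
  exists c, forall n, eval (fun=> 0) c n (p n).

(* A partial function F on Baire space is given by its graph: [F p q] means that
   F(p) is defined and equal to q. All the graphs used below are single-valued,
   see [computable_pfun_functional] and [eta_functional]. *)
Definition pfun := baire -> set baire.

(* Type-2 computability: one machine which, having the input p as oracle, produces
   every entry of the infinite output F(p); F(p) is undefined as soon as one entry
   is not produced. *)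
Definition computable_pfun (F : pfun) : Prop :=
  exists c, forall p q, F p q <-> forall n, eval p c n (q n).

Lemma eval_functional p c n m m' : eval p c n m -> eval p c n m' -> m = m'.
Proof.
elim: c n m m' => [||||| c1 IH1 c2 IH2 | c1 IH1 c2 IH2 | c1 IH1 c2 IH2 | c1 IH1]
  n m m' /=; try by move=> -> ->.
- move=> [k [k1 k2]] [k' [k1' k2']].
  by rewrite -(IH2 _ _ _ k1 k1') in k2'; exact: IH1 k2 k2'.
- move=> [i [j [hi hj ->]]] [i' [j' [hi' hj' ->]]].
  by rewrite (IH1 _ _ _ hi hi') (IH2 _ _ _ hj hj').
- move=> [v [v0 vS ->]] [w [w0 wS ->]].
  suff vw i : i <= csnd n -> v i = w i by exact: vw.
  elim: i => [_|i IHi lti]; first exact: IH1 v0 w0.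
  have := wS i lti; rewrite -IHi; last exact: ltnW.
  exact: IH2 (vS i lti).
- move=> [m0 lm] [m0' lm']; case: (ltngtP m m') => // [/lm'|/lm] [k hk].
  + by have := IH1 _ _ _ m0 hk.
  + by have := IH1 _ _ _ m0' hk.
Qed.

Lemma computable_pfun_functional F p q q' :
  computable_pfun F -> F p q -> F p q' -> q = q'.
Proof.
by move=> [c Fc] /Fc h /Fc h'; apply/funext => n; exact: eval_functional (h n) (h' n).
Qed.

(* The standard representation of the continuous partial functions on Baire space
   with G_delta domain, in the form of Kleene's associates: to find entry n of
   [eta p q], query p on the words n :: q|k for k = 0, 1, 2, ...; the answer 0
   means "no decision yet" and the first answer of the form m + 1 means "entry n
   is m". *)
Definition eta (p : baire) : pfun := fun q r =>
  forall n, exists k, p (wcode (n :: mkseq q k)) = (r n).+1 /\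
    forall j, j < k -> p (wcode (n :: mkseq q j)) = 0.

Lemma eta_functional p q r r' : eta p q r -> eta p q r' -> r = r'.
Proof.
move=> h h'; apply/funext => n.
have [k [hk lk]] := h n; have [k' [hk' lk']] := h' n.
case: (ltngtP k k') => [/lk'|/lk|kk']; rewrite ?hk ?hk' //.
by move: hk; rewrite kk' hk' => -[].
Qed.

(* [d p x]: p is a d-name of x. *)
Definition rep (T : Type) := baire -> T -> Prop.

Definition has_computable_name (T : Type) (d : rep T) (x : T) : Prop :=
  exists p, computable_point p /\ d p x.

(* D is the domain of the operation, f x its set of values at x \in D; d' is meant
   to be single-valued. *)
Definition realiser (T U : Type) (d : rep T) (d' : rep U)
    (D : set T) (f : T -> set U) (F : pfun) : Prop :=
  forall p x, d p x -> D x -> exists q, F p q /\ exists y, d' q y /\ f x y.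

Definition computable_op (T U : Type) (d : rep T) (d' : rep U)
    (D : set T) (f : T -> set U) : Prop :=
  exists F, computable_pfun F /\ realiser d d' D f F.

Definition rep_prod (T U : Type) (d : rep T) (d' : rep U) : rep (T * U) :=
  fun r xy => d (bproj 0 r) xy.1 /\ d' (bproj 1 r) xy.2.

Definition rep_meet (T : Type) (d d' : rep T) : rep T :=
  fun r x => d (bproj 0 r) x /\ d' (bproj 1 r) x.

(* [d -> d'], a representation of the total maps with a continuous realiser. *)
Definition rep_fun (T U : Type) (d : rep T) (d' : rep U) : rep (T -> U) :=
  fun p f => realiser d d' setT (fun x => [set f x]) (eta p).

Definition nuQ (n : nat) : rat :=
  (((cfst (cfst n))%:Z - (csnd (cfst n))%:Z)%:~R / (csnd n).+1%:R)%R.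

Definition nuQpos (n : nat) : rat := ((cfst n).+1%:R / (csnd n).+1%:R)%R.

Definition computable_dseq (R : realType) (u : nat -> nat -> R) : Prop :=
  exists f, computable_point f /\
    forall i j k, (`|u i j - ratr (nuQ (f (cpair (cpair i j) k)))| <= 2 ^- k)%R.

Definition rho_lower (R : realType) : rep (\bar R) := fun p t =>
  [set n | ((ratr (nuQ n) : R)%:E < t)%E] =
  [set (p i).-1 | i in [set i | 1 <= p i]].

Section ComputableMetricSpace.
Context {R : realType} {X : metricType R} (nu : nat -> X).

Definition computable_metric_space : Prop :=
  dense (range nu) /\ computable_dseq (fun i j => mdist (nu i) (nu j)).

Definition delta_X : rep X := fun p x =>
  (nu (p i) @[i --> \oo] --> x) /\
  forall i j, (mdist (nu (p i)) (nu (p j)) < 2 ^- minn i j)%R.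

Definition alpha (n : nat) : set X := ball (nu (cfst n)) (ratr (nuQpos (csnd n))).

Definition delta_Sigma : rep (set X) := fun p U =>
  U = \bigcup_(i in [set i | 1 <= p i]) alpha (p i).-1.

Definition delta_Pi : rep (set X) := fun p A => delta_Sigma p (~` A).

Definition delta_Delta : rep (set X) := fun r W =>
  delta_Sigma (bproj 0 r) W /\ delta_Pi (bproj 1 r) W.

Definition delta_cover : rep (set X) := fun p K => compact K /\
  range p = [set wcode w | w in [set w : seq nat |
               K `<=` \bigcup_(n in [set` w]) alpha n]].

Definition delta_range : rep (set X) := fun p A => closed A /\
  ((A = set0 /\ forall i j, bcomp i p j = 0) \/
   [/\ A !=set0,
       forall i j, 1 <= bcomp i p j
     & exists a : nat -> X,
         (forall i, A (a i) /\ delta_X (fun j => (bcomp i p j).-1) (a i)) /\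
         A `<=` closure (range a)]).

(* The infimum of the empty set is +oo. *)
Definition dist_to (A : set X) (x : X) : \bar R :=
  ereal_inf [set (mdist x a)%:E | a in A].

Definition delta_dist_gt : rep (set X) := fun p A => closed A /\
  realiser delta_X (@rho_lower R) setT (fun x => [set dist_to A x]) (eta p).

End ComputableMetricSpace.

(* Not the library's [zero_dimensional], which only separates points by clopen
   sets. Metrisability is part of the type of [X]. *)
Definition zero_dim {R : realType} (X : metricType R) : Prop :=
  [/\ [set: X] !=set0,
      exists S : set X, countable S /\ dense S
    & exists B : set_system X, basis B /\ B `<=` clopen].

Section Operations.
Context {R : realType} {X : metricType R}.

Definition dom_E : set (set X) := [set A | closed A /\ A !=set0].

Definition op_E (A : set X) : set (X -> X) :=
  [set f | [/\ continuous f, range f = A & forall a, A a -> f a = a]].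

Definition dom_M : set (X * set X) := [set xU | open xU.2 /\ xU.2 xU.1].

Definition op_M (xU : X * set X) : set (set X) :=
  [set W | [/\ clopen W, W xU.1 & W `<=` xU.2]].

End Operations.

(* Main.v *)
From HB Require Import structures.
Require Import Defs.
From Stdlib Require Cantor.
From mathcomp Require Import all_boot all_order all_algebra.
From mathcomp Require Import all_classical all_reals all_analysis.
From mathcomp Require Import zify ring lra.
Local Open Scope classical_set_scope.

(* If x <> y, a retraction f of X onto {x, y}
   splits X into the clopen sets {f <> y} and {f <> x}. From Cauchy names of x and
   y one computes a name of {x, y}, hence an associate of such an f. Only finite
   prefixes of the two Cauchy names are used to see that f sends x near x and y
   near y, so the names may be cut off: replacing x and y by points of the dense
   sequence with eventually constant names still gives a retraction whose clopen
   sets separate x from y. There are countably many eventually constant names, and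
   they yield a uniformly computable sequence of clopen sets, of which, X being
   compact, the finite intersections form a basis. Given x in U, one searches for a
   finite intersection W that contains x such that U and the complement of W cover
   X; the latter can be confirmed from the list of all finite covers of X. *)

Set Implicit Arguments.
Unset Strict Implicit.
Unset Printing Implicit Defensive.
Import Order.TTheory GRing.Theory Num.Theory.
Import numFieldNormedType.Exports.
Import metricType_numDomainType.
Local Open Scope nat_scope.

Local Notation eval := Defs.eval.

(** * Computable functionals *)

Lemma cfstK i j : cfst (cpair i j) = i.
Proof. by rewrite /cfst /cpair Cantor.cancel_of_to. Qed.

Lemma csndK i j : csnd (cpair i j) = j.
Proof. by rewrite /csnd /cpair Cantor.cancel_of_to. Qed.

Lemma cpairK n : cpair (cfst n) (csnd n) = n.
Proof. by rewrite /cpair /cfst /csnd -surjective_pairing Cantor.cancel_to_of. Qed.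

Lemma leq_csnd n : csnd n <= n.
Proof.
rewrite -[n in _ <= n]cpairK /cpair.
have := Cantor.to_nat_non_decreasing (cfst n) (csnd n); lia.
Qed.

(** Functionals total for every oracle; tests count as 0 or 1. Partiality enters only through the
    program for the retractions and the final [Mu] search. *)
Definition recursive (F : baire -> nat -> nat) : Prop :=
  exists c, forall p n, eval p c n (F p n).

Lemma rec_const k : recursive (fun _ _ => k).
Proof.
elim: k => [|k [c IH]]; first by exists Zero.
by exists (Comp Succ c) => p n /=; exists k.
Qed.

Lemma rec_id : recursive (fun _ n => n).
Proof.
by exists (Pair Fst Snd) => p n /=; exists (cfst n), (csnd n); rewrite cpairK.
Qed.

Lemma rec_fst f : recursive f -> recursive (fun p n => cfst (f p n)).
Proof. by move=> [c hc]; exists (Comp Fst c) => p n /=; exists (f p n). Qed.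

Lemma rec_snd f : recursive f -> recursive (fun p n => csnd (f p n)).
Proof. by move=> [c hc]; exists (Comp Snd c) => p n /=; exists (f p n). Qed.

Lemma rec_succ f : recursive f -> recursive (fun p n => (f p n).+1).
Proof. by move=> [c hc]; exists (Comp Succ c) => p n /=; exists (f p n). Qed.

Lemma rec_oracle f : recursive f -> recursive (fun p n => p (f p n)).
Proof. by move=> [c hc]; exists (Comp Oracle c) => p n /=; exists (f p n). Qed.

Lemma rec_pair f g : recursive f -> recursive g ->
  recursive (fun p n => cpair (f p n) (g p n)).
Proof.
move=> [c hc] [d hd]; exists (Pair c d) => p n /=.
by exists (f p n), (g p n).
Qed.

Lemma rec_subst h f : recursive h -> recursive f -> recursive (fun p n => h p (f p n)).
Proof. by move=> [c hc] [d hd]; exists (Comp c d) => p n /=; exists (f p n). Qed.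

Lemma rec2 (h : baire -> nat -> nat -> nat) f g :
  recursive (fun p n => h p (cfst n) (csnd n)) -> recursive f -> recursive g ->
  recursive (fun p n => h p (f p n) (g p n)).
Proof.
move=> hh hf hg; have := rec_subst hh (rec_pair hf hg).
by under [X in recursive X]eq_fun do under eq_fun do rewrite cfstK csndK.
Qed.

Lemma rec3 (h : baire -> nat -> nat -> nat -> nat) f1 f2 f3 :
  recursive (fun p n => h p (cfst n) (cfst (csnd n)) (csnd (csnd n))) ->
  recursive f1 -> recursive f2 -> recursive f3 ->
  recursive (fun p n => h p (f1 p n) (f2 p n) (f3 p n)).
Proof.
move=> hh h1 h2 h3; have := rec_subst hh (rec_pair h1 (rec_pair h2 h3)).
by under [X in recursive X]eq_fun do under eq_fun do rewrite !(cfstK, csndK).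
Qed.

Lemma rec_iteri (F : baire -> nat -> nat -> nat -> nat) m x0 :
  recursive m -> recursive x0 ->
  recursive (fun p a => F p (cfst a) (cfst (csnd a)) (csnd (csnd a))) ->
  recursive (fun p n => iteri (m p n) (F p n) (x0 p n)).
Proof.
move=> [cm hm] [c0 h0] [cF hF].
exists (Comp (Rec c0 cF) (Pair (Pair Fst Snd) cm)) => p n /=.
exists (cpair n (m p n)); split.
  by exists n, (m p n); split => //; exists (cfst n), (csnd n); rewrite cpairK.
exists (fun i => iteri i (F p n) (x0 p n)); rewrite !(cfstK, csndK); split => // i _.
by have := hF p (cpair n (cpair i (iteri i (F p n) (x0 p n)))); rewrite !(cfstK, csndK).
Qed.

(** An empty hook, redefined below as further closure lemmas become available. *)
Ltac recursive_ext := fail.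
Ltac recursive1 := match goal with |- recursive _ => cbv beta; first
 [ assumption | simple apply rec_const | simple apply rec_id | recursive_ext
 | simple apply rec_fst | simple apply rec_snd | simple apply rec_succ
 | simple apply rec_pair | simple apply rec_oracle | simple apply rec_iteri ] end.
Ltac recursive := repeat recursive1.

Lemma rec_iter (F : baire -> nat -> nat -> nat) m x0 :
  recursive m -> recursive x0 -> recursive (fun p a => F p (cfst a) (csnd a)) ->
  recursive (fun p n => iter (m p n) (F p n) (x0 p n)).
Proof.
move=> hm h0 hF.
have -> : (fun p n => iter (m p n) (F p n) (x0 p n)) =
          (fun p n => iteri (m p n) (fun _ v => F p n v) (x0 p n)).
  by apply/funext => p; apply/funext => n; elim: (m p n) => //= k ->.
by recursive; apply: (rec2 (h := F)) => //; recursive.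
Qed.

Lemma rec_add f g : recursive f -> recursive g -> recursive (fun p n => f p n + g p n).
Proof.
move=> hf hg.
have -> : (fun p n => f p n + g p n) =
          (fun p n => iteri (g p n) (fun _ v => v.+1) (f p n)).
  by apply/funext => p; apply/funext => n; elim: (g p n) => [|k IH] /=;
     rewrite ?addn0 // -IH addnS.
by recursive.
Qed.

Lemma rec_mul f g : recursive f -> recursive g -> recursive (fun p n => f p n * g p n).
Proof.
move=> hf hg.
have -> : (fun p n => f p n * g p n) =
          (fun p n => iteri (g p n) (fun _ v => v + f p n) 0).
  by apply/funext => p; apply/funext => n; elim: (g p n) => [|k IH] /=;
     rewrite ?muln0 // -IH mulnSr.
recursive; apply: rec_add; recursive.
exact: (rec_subst hf (rec_fst rec_id)).
Qed.

Lemma rec_pred f : recursive f -> recursive (fun p n => (f p n).-1).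
Proof.
move=> hf.
have -> : (fun p n => (f p n).-1) = (fun p n => iteri (f p n) (fun i _ => i) 0).
  by apply/funext => p; apply/funext => n; elim: (f p n).
by recursive.
Qed.

Lemma rec_sub f g : recursive f -> recursive g -> recursive (fun p n => f p n - g p n).
Proof.
move=> hf hg.
have -> : (fun p n => f p n - g p n) =
          (fun p n => iteri (g p n) (fun _ v => v.-1) (f p n)).
  by apply/funext => p; apply/funext => n; elim: (g p n) => [|k IH] /=;
     rewrite ?subn0 // -IH subnS.
by recursive; apply: rec_pred; recursive.
Qed.

Lemma rec_exp f g : recursive f -> recursive g -> recursive (fun p n => f p n ^ g p n).
Proof.
move=> hf hg.
have -> : (fun p n => f p n ^ g p n) =
          (fun p n => iteri (g p n) (fun _ v => v * f p n) 1).
  by apply/funext => p; apply/funext => n; elim: (g p n) => [|k IH] //=;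
     rewrite -IH expnSr.
recursive; apply: rec_mul; recursive.
exact: (rec_subst hf (rec_fst rec_id)).
Qed.

Lemma rec_negb b : recursive (fun p n => b p n : bool) -> recursive (fun p n => ~~ b p n).
Proof.
move=> hb.
have -> : (fun p n => nat_of_bool (~~ b p n)) = (fun p n => 1 - b p n).
  by apply/funext => p; apply/funext => n; case: (b p n).
by apply: rec_sub; recursive.
Qed.

Lemma rec_leq f g : recursive f -> recursive g -> recursive (fun p n => f p n <= g p n).
Proof.
move=> hf hg.
have -> : (fun p n => nat_of_bool (f p n <= g p n)) = (fun p n => 1 - (f p n - g p n)).
  by apply/funext => p; apply/funext => n; lia.
by apply: rec_sub; recursive; apply: rec_sub.
Qed.

Lemma rec_andb b b' : recursive (fun p n => b p n : bool) ->
  recursive (fun p n => b' p n : bool) ->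
  recursive (fun p n => b p n && b' p n).
Proof.
move=> hb hb'.
have -> : (fun p n => nat_of_bool (b p n && b' p n)) = (fun p n => b p n * b' p n).
  by apply/funext => p; apply/funext => n; rewrite mulnb.
exact: rec_mul.
Qed.

Lemma rec_orb b b' : recursive (fun p n => b p n : bool) ->
  recursive (fun p n => b' p n : bool) ->
  recursive (fun p n => b p n || b' p n).
Proof.
move=> hb hb'.
have -> : (fun p n => nat_of_bool (b p n || b' p n)) =
          (fun p n => ~~ (~~ b p n && ~~ b' p n)).
  by apply/funext => p; apply/funext => n; rewrite negb_and !negbK.
by apply: rec_negb; apply: rec_andb; apply: rec_negb.
Qed.

Lemma rec_eq f g : recursive f -> recursive g -> recursive (fun p n => f p n == g p n).
Proof.
move=> hf hg.
have -> : (fun p n => nat_of_bool (f p n == g p n)) =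
          (fun p n => (f p n <= g p n) && (g p n <= f p n)).
  by apply/funext => p; apply/funext => n; rewrite eqn_leq.
by apply: rec_andb; apply: rec_leq.
Qed.

Lemma rec_if b f g : recursive (fun p n => b p n : bool) -> recursive f -> recursive g ->
  recursive (fun p n => if b p n then f p n else g p n).
Proof.
move=> hb hf hg.
have -> : (fun p n => if b p n then f p n else g p n) =
          (fun p n => b p n * f p n + ~~ b p n * g p n).
  by apply/funext => p; apply/funext => n; case: (b p n); rewrite ?mul1n ?addn0.
by apply: rec_add; apply: rec_mul => //; apply: rec_negb.
Qed.

Lemma rec_all (B : baire -> nat -> nat -> bool) m : recursive m ->
  recursive (fun p a => B p (cfst a) (csnd a)) ->
  recursive (fun p n => all (B p n) (iota 0 (m p n))).
Proof.
move=> hm hB.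
have -> : (fun p n => nat_of_bool (all (B p n) (iota 0 (m p n)))) =
          (fun p n => iteri (m p n) (fun i v => v * B p n i) 1).
  apply/funext => p; apply/funext => n; elim: (m p n) => // k IH.
  by rewrite -{1}[k.+1]addn1 iotaD all_cat /= andbT add0n -IH mulnb.
recursive; apply: rec_mul; recursive.
by apply: (rec2 (h := fun p n i => nat_of_bool (B p n i))) => //; recursive.
Qed.

Lemma rec_has (B : baire -> nat -> nat -> bool) m : recursive m ->
  recursive (fun p a => B p (cfst a) (csnd a)) ->
  recursive (fun p n => has (B p n) (iota 0 (m p n))).
Proof.
move=> hm hB.
have -> : (fun p n => nat_of_bool (has (B p n) (iota 0 (m p n)))) =
          (fun p n => ~~ all (fun i => ~~ B p n i) (iota 0 (m p n))).
  by apply/funext => p; apply/funext => n; rewrite -has_predC; congr nat_of_bool;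
     apply: eq_has => i /=; rewrite negbK.
by apply: rec_negb; apply: (@rec_all (fun p n i => ~~ B p n i)) => //; apply: rec_negb.
Qed.

Ltac recursive_ext ::= first
 [ simple apply rec_add | simple apply rec_mul | simple apply rec_sub
 | simple apply rec_pred | simple apply rec_exp | simple apply rec_negb
 | simple apply rec_leq | simple apply rec_andb | simple apply rec_orb
 | simple apply rec_eq | simple apply rec_if | simple apply rec_all
 | simple apply rec_has | simple apply rec_iter].

Lemma rec_odd f : recursive f -> recursive (fun p n => odd (f p n)).
Proof.
move=> hf.
have -> : (fun p n => nat_of_bool (odd (f p n))) =
          (fun p n => iteri (f p n) (fun _ v => 1 - v) 0).
  by apply/funext => p; apply/funext => n; elim: (f p n) => //= k <-; case: odd.
by recursive.
Qed.

Lemma rec_half f : recursive f -> recursive (fun p n => (f p n)./2).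
Proof.
move=> hf.
have -> : (fun p n => (f p n)./2) =
          (fun p n => iteri (f p n) (fun i v => v + odd i) 0).
  by apply/funext => p; apply/funext => n; elim: (f p n) => //= k <-; lia.
by recursive; apply: rec_odd; recursive.
Qed.

(* [g] computes a family of oracles [o e]: entry [i] of [o e] is found on input
   [cpair e i]. The parameter [e] is carried along in the first component. *)
Fixpoint oracle_subst (g c : prog) : prog :=
  match c with
  | Zero => Zero
  | Succ => Comp Succ Snd
  | Fst => Comp Fst Snd
  | Snd => Comp Snd Snd
  | Oracle => g
  | Comp c1 c2 => Comp (oracle_subst g c1) (Pair Fst (oracle_subst g c2))
  | Pair c1 c2 => Pair (oracle_subst g c1) (oracle_subst g c2)
  | Rec c1 c2 =>
      Comp (Rec (oracle_subst g c1)
             (Comp (oracle_subst g c2) (Pair (Comp Fst Fst) (Pair (Comp Snd Fst) Snd))))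
           (Pair (Pair Fst (Comp Fst Snd)) (Comp Snd Snd))
  | Mu c1 => Mu (Comp (oracle_subst g c1) (Pair (Comp Fst Fst) (Pair (Comp Snd Fst) Snd)))
  end.

Lemma eval_oracle_subst p g e o c n m :
  (forall i, eval p g (cpair e i) (o i)) ->
  eval o c n m -> eval p (oracle_subst g c) (cpair e n) m.
Proof.
move=> go.
(* The loops of [Rec] and [Mu] attach their data to the whole input [cpair e n]; this repacking
   keeps the parameter [e] outermost. *)
have E e0 n0 r : eval p (Pair (Comp Fst Fst) (Pair (Comp Snd Fst) Snd))
    (cpair (cpair e0 n0) r) (cpair e0 (cpair n0 r)).
  exists e0, (cpair n0 r); split => //=.
    by exists (cpair e0 n0); rewrite !cfstK.
  by exists n0, r; split; rewrite ?csndK //; exists (cpair e0 n0); rewrite ?cfstK ?csndK.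
elim: c n m => [||||| c1 IH1 c2 IH2 | c1 IH1 c2 IH2 | c1 IH1 c2 IH2 | c1 IH1] n m;
  rewrite /=; try by (move=> -> //; exists n; rewrite csndK).
- move=> [k [/IH2 h2 /IH1 h1]]; exists (cpair e k); split => //.
  by exists e, k; rewrite cfstK.
- by move=> [i [j [/IH1 h1 /IH2 h2 ->]]]; exists i, j.
- move=> [v [/IH1 h1 h2 ->]].
  exists (cpair (cpair e (cfst n)) (csnd n)); split.
    exists (cpair e (cfst n)), (csnd n); split => //.
      exists e, (cfst n); split; rewrite ?cfstK //.
      by exists n; rewrite csndK.
    by exists n; rewrite csndK.
  exists v; rewrite cfstK csndK; split => // i /h2/IH2 h.
  by exists (cpair e (cpair (cfst n) (cpair i (v i)))); split; first exact: E.
- move=> [/IH1 h1 h2]; split.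
    by exists (cpair e (cpair n m)); split; first exact: E.
  by move=> i /h2[k /IH1 hk]; exists k, (cpair e (cpair n i)); split; first exact: E.
Qed.

(** The program for [f] expects the oracle 0^omega, so its oracle calls are replaced by [Zero]; the
    parameter 0 is a dummy. *)
Lemma rec_point f g : computable_point f -> recursive g -> recursive (fun p n => f (g p n)).
Proof.
move=> [c hc] hg; apply: (rec_subst (h := fun _ => f)) => //.
exists (Comp (oracle_subst Zero c) (Pair Zero (Pair Fst Snd))) => p n.
exists (cpair 0 n); split; last exact: eval_oracle_subst.
by exists 0, n; split => //; exists (cfst n), (csnd n); rewrite cpairK.
Qed.

(** The use principle: a halting computation consults finitely many oracle entries. [bnd] merges the
    bounds of the finitely many subcomputations of [Rec] and [Mu]. *)
Lemma eval_use p c n m : eval p c n m ->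
  exists L, forall p', (forall i, i < L -> p' i = p i) -> eval p' c n m.
Proof.
have bnd k (Q : nat -> baire -> Prop) :
    (forall i, i < k -> exists L, forall p', (forall j, j < L -> p' j = p j) -> Q i p') ->
    exists L, forall p', (forall j, j < L -> p' j = p j) -> forall i, i < k -> Q i p'.
  elim: k => [|k IH] h; first by exists 0.
  have [L1 h1] := IH (fun i ik => h i (ltnW ik)).
  have [L2 h2] := h k (ltnSn k).
  exists (maxn L1 L2) => p' hp i; rewrite ltnS leq_eqVlt => /orP[/eqP ->|ik].
    by apply: h2 => j jL; apply: hp; rewrite leq_max jL orbT.
  by apply: h1 ik => j jL; apply: hp; rewrite leq_max jL.
elim: c n m => [||||| c1 IH1 c2 IH2 | c1 IH1 c2 IH2 | c1 IH1 c2 IH2 | c1 IH1] n m /=;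
  try by (move=> ->; exists 0).
- by move=> ->; exists n.+1 => p' ->.
- move=> [k [/IH2[L2 h2] /IH1[L1 h1]]]; exists (maxn L1 L2) => p' hp.
  exists k; split; [apply: h2|apply: h1] => i iL; apply: hp; rewrite leq_max iL //.
  by rewrite orbT.
- move=> [i [j [/IH1[L1 h1] /IH2[L2 h2] ->]]]; exists (maxn L1 L2) => p' hp.
  exists i, j; split => //; [apply: h1|apply: h2] => k kL; apply: hp; rewrite leq_max kL //.
  by rewrite orbT.
- move=> [v [/IH1[L1 h1] h2 ->]].
  have [L2 {}h2] := bnd _ (fun i p' => eval p' c2 (cpair (cfst n) (cpair i (v i))) (v i.+1))
    (fun i ik => IH2 _ _ (h2 i ik)).
  exists (maxn L1 L2) => p' hp; exists v; split => //.
    by apply: h1 => k kL; apply: hp; rewrite leq_max kL.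
  by apply: h2 => k kL; apply: hp; rewrite leq_max kL orbT.
- move=> [/IH1[L1 h1] h2].
  have [|L2 {}h2] := bnd m (fun i p' => exists k, eval p' c1 (cpair n i) k.+1).
    by move=> i /h2[k /IH1[L hL]]; exists L => p' /hL; exists k.
  exists (maxn L1 L2) => p' hp; split.
    by apply: h1 => k kL; apply: hp; rewrite leq_max kL.
  by apply: h2 => k kL; apply: hp; rewrite leq_max kL orbT.
Qed.

(** * Words and rational tests *)

Definition word_tail (c : nat) : nat := wcode (behead (CodeSeq.decode c)).
Definition word_nth (c i : nat) : nat := nth 0 (CodeSeq.decode c) i.

Lemma iter_word_tail i c : iter i word_tail c = wcode (drop i (CodeSeq.decode c)).
Proof.
elim: i => [|i IH]; first by rewrite /= drop0 /wcode CodeSeq.decodeK.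
by rewrite iterS IH /word_tail /wcode CodeSeq.codeK -drop1 drop_drop add1n.
Qed.

Lemma wcode_eq0 w : (wcode w == 0) = (w == [::]).
Proof. by case: w => //= n w; rewrite /wcode /= muln_eq0 expn_eq0. Qed.

Lemma word_size_gt i c : (iter i word_tail c != 0) = (i < size (CodeSeq.decode c)).
Proof. by rewrite iter_word_tail wcode_eq0 -size_eq0 size_drop subn_eq0 ltnNge. Qed.

Lemma size_wcode w : size w <= wcode w.
Proof.
elim: w => //= n w IH; rewrite /wcode /= -/(wcode w).
by apply: leq_trans (leq_pmull _ _); rewrite ?expn_gt0 // ltnS -addnn; lia.
Qed.

(** A word is no longer than its code, so the code bounds the loop; positions past the end are
    recognised by the empty tail, whose code is 0. *)
Lemma all_word (P : pred nat) c :
  all P (CodeSeq.decode c) =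
  all (fun i => (iter i word_tail c == 0) || P (word_nth c i)) (iota 0 c).
Proof.
apply/(all_nthP 0)/allP => h i.
  move=> _; case: eqP => //= /eqP; rewrite word_size_gt => /h; exact.
move=> iw; have := h i; rewrite mem_iota /= add0n -[_ == 0]negbK word_size_gt iw; apply.
by apply: leq_trans iw _; have := size_wcode (CodeSeq.decode c); rewrite /wcode CodeSeq.decodeK.
Qed.

(** The code of a word with head n and tail code m is 2^n (2m + 1). Iteration strips the factor 2^n
    and then stays at the odd part. *)
Definition unhalve (v : nat) : nat := if odd v then v else v./2.

Lemma iter_unhalve n m k : iter k unhalve (2 ^ n * m.*2.+1) = 2 ^ (n - k) * m.*2.+1.
Proof.
elim: k => [|k IH]; rewrite ?subn0 // iterS IH subnS /unhalve oddM oddX /= odd_double.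
by case: (n - k) => // j; rewrite /= expnS -mulnA mul2n doubleK.
Qed.

Lemma word_tailE c : word_tail c = (iter c unhalve c)./2.
Proof.
rewrite /word_tail -{2 3}[c]CodeSeq.decodeK.
case: (CodeSeq.decode c) => // n w /=; rewrite -/(wcode w).
rewrite iter_unhalve; set N := (X in _ - X).
(* As n < 2^n, iterating as often as the code itself removes the whole power of 2. *)
have -> : n - N = 0.
  apply/eqP; rewrite subn_eq0 /N; apply: leq_trans (leq_pmulr _ _) => //.
  exact: ltnW (ltn_expl n _).
by rewrite mul1n /= uphalf_double.
Qed.

(** The head is the exponent of 2 in the code, that is, the number of even iterates; for the empty
    word the loop is empty and gives the default 0. *)
Lemma word_headE c :
  word_nth c 0 = iteri c (fun i v => v + ~~ odd (iter i unhalve c)) 0.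
Proof.
rewrite /word_nth -{2 3}[c]CodeSeq.decodeK.
case: (CodeSeq.decode c) => // n w /=; set c' := _ * _.
have h k : iteri k (fun i v => v + ~~ odd (iter i unhalve c')) 0 = minn n k.
  elim: k => [|k /= ->]; first by rewrite minn0.
  by rewrite iter_unhalve oddM oddX /= odd_double; lia.
rewrite h; apply/esym/minn_idPl; apply: leq_trans (leq_pmulr _ _) => //.
exact: ltnW (ltn_expl n _).
Qed.

Lemma word_nthE c i : word_nth c i = word_nth (iter i word_tail c) 0.
Proof. by rewrite iter_word_tail /word_nth /wcode CodeSeq.codeK nth_drop addn0. Qed.

Lemma rec_unhalve : recursive (fun _ => unhalve).
Proof. by rewrite /unhalve; recursive; [apply: rec_odd|apply: rec_half]; recursive. Qed.

Lemma rec_word_tail f : recursive f -> recursive (fun p n => word_tail (f p n)).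
Proof.
move=> hf; apply: (rec_subst (h := fun _ => word_tail)) => //.
rewrite (funext word_tailE).
apply: rec_half; recursive.
by apply: (rec_subst rec_unhalve); recursive.
Qed.

Lemma rec_word_nth f g : recursive f -> recursive g ->
  recursive (fun p n => word_nth (f p n) (g p n)).
Proof.
move=> hf hg; apply: (rec2 (h := fun _ c i => word_nth c i)) => //.
under [X in recursive X]eq_fun do under eq_fun do rewrite word_nthE.
apply: (rec_subst (h := fun _ c => word_nth c 0)); last first.
  by recursive; apply: rec_word_tail; recursive.
under [X in recursive X]eq_fun do under eq_fun do rewrite word_headE.
by recursive; apply: rec_odd; recursive; apply: (rec_subst rec_unhalve); recursive.
Qed.

Lemma rec_double f : recursive f -> recursive (fun p n => (f p n).*2).
Proof.
move=> hf; under [X in recursive X]eq_fun do under eq_fun do rewrite -mul2n.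
by recursive.
Qed.

Lemma rec_wcode_mkseq (r : baire -> nat -> nat -> nat) k :
  recursive k -> recursive (fun p a => r p (cfst a) (csnd a)) ->
  recursive (fun p n => wcode (mkseq (r p n) (k p n))).
Proof.
move=> hk hr.
(* The code is a right fold, so the word is built from its last letter: round [i] prepends letter K
   - i - 1. *)
have -> : (fun p n => wcode (mkseq (r p n) (k p n))) = (fun p n =>
   iteri (k p n) (fun i v => 2 ^ r p n (k p n - i.+1) * v.*2.+1) 0).
  apply/funext => p; apply/funext => n; set K := k p n.
  have h i : i <= K -> iteri i (fun i v => 2 ^ r p n (K - i.+1) * v.*2.+1) 0 =
     wcode [seq r p n j | j <- iota (K - i) i].
    elim: i => // i IH iK; rewrite /= IH ?(ltnW iK) //.
    by rewrite (_ : (K - i.+1).+1 = K - i) //; lia.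
  by rewrite h // subnn.
recursive; last exact/rec_double/rec_snd/rec_snd/rec_id.
apply: (rec2 (h := r)) => //; recursive.
by apply: (rec_subst hk); recursive.
Qed.

(** The inequality a + C 2^-s < b between coded rationals, cleared of denominators and of
    subtractions. *)
Definition qlt (a b C s : nat) : bool :=
  cfst (cfst a) * 2 ^ s * (csnd b).+1 + C * (csnd a).+1 * (csnd b).+1 +
  csnd (cfst b) * 2 ^ s * (csnd a).+1 <
  cfst (cfst b) * 2 ^ s * (csnd a).+1 + csnd (cfst a) * 2 ^ s * (csnd b).+1.

Lemma qltP (R : realType) a b C s :
  qlt a b C s = (ratr (nuQ a) + C%:R * 2 ^- s < ratr (nuQ b) :> R)%R.
Proof.
have E n : ratr (nuQ n) = (((cfst (cfst n))%:R - (csnd (cfst n))%:R) / (csnd n).+1%:R :> R)%R.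
  by rewrite /nuQ rmorphM fmorphV rmorph_nat rmorph_int intrB.
rewrite !{}E /qlt -(ltr_nat R) !natrD !natrM !natrX.
set xa := (cfst (cfst a))%:R%R; set ya := (csnd (cfst a))%:R%R.
set xb := (cfst (cfst b))%:R%R; set yb := (csnd (cfst b))%:R%R.
have := ltr0Sn R (csnd a); have := ltr0Sn R (csnd b).
set cb := (csnd b).+1%:R%R; set ca := (csnd a).+1%:R%R.
have : (0 < 2 ^+ s :> R)%R by rewrite exprn_gt0.
set S := (2 ^+ s)%R => S0 cb0 ca0.
rewrite -[RHS](ltr_pM2r (mulr_gt0 (mulr_gt0 S0 ca0) cb0)).
rewrite -[LHS]subr_gt0 -[RHS]subr_gt0; congr (0 < _)%R.
by field; rewrite !gt_eqF.
Qed.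

Lemma nuQ0 (R : realType) : ratr (nuQ 0) = 0%R :> R.
Proof. by rewrite /nuQ /= subrr mul0r rmorph0. Qed.

Lemma nuQ_half_pow (R : realType) k :
  ratr (nuQ (cpair (cpair 1 0) (2 ^ k).-1)) = (2 ^- k)%R :> R.
Proof.
rewrite /nuQ !(cfstK, csndK) subr0 rmorphM fmorphV.
by rewrite prednK ?expn_gt0 // rmorph1 mul1r rmorph_nat natrX.
Qed.

Lemma rec_qlt a b C s : recursive a -> recursive b -> recursive C -> recursive s ->
  recursive (fun p n => qlt (a p n) (b p n) (C p n) (s p n)).
Proof. by move=> *; rewrite /qlt; recursive. Qed.

Ltac recursive_ext ::= first
 [ simple apply rec_add | simple apply rec_mul | simple apply rec_sub
 | simple apply rec_pred | simple apply rec_exp | simple apply rec_negb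
 | simple apply rec_qlt | simple apply rec_word_tail | simple apply rec_word_nth
 | simple apply rec_odd | simple apply rec_half | simple apply rec_double
 | simple apply rec_wcode_mkseq
 | simple apply rec_leq | simple apply rec_andb | simple apply rec_orb
 | simple apply rec_eq | simple apply rec_if | simple apply rec_all
 | simple apply rec_has | simple apply rec_iter].

Lemma rec_all_word (B : baire -> nat -> nat -> bool) c : recursive c ->
  recursive (fun p a => B p (cfst a) (csnd a)) ->
  recursive (fun p n => all (B p n) (CodeSeq.decode (c p n))).
Proof.
move=> hc hB; under [X in recursive X]eq_fun do under eq_fun do rewrite all_word.
recursive; first by apply: (rec_subst hc); recursive.
apply: (rec2 (h := fun p n i => nat_of_bool (B p n i))) => //; recursive.
by apply: (rec_subst hc); recursive.
Qed.

Lemma has_word (P : pred nat) c :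
  has P (CodeSeq.decode c) = ~~ all (predC P) (CodeSeq.decode c).
Proof. by rewrite -has_predC; apply: eq_has => i /=; rewrite negbK. Qed.

Lemma rec_has_word (B : baire -> nat -> nat -> bool) c : recursive c ->
  recursive (fun p a => B p (cfst a) (csnd a)) ->
  recursive (fun p n => has (B p n) (CodeSeq.decode (c p n))).
Proof.
move=> hc hB; under [X in recursive X]eq_fun do under eq_fun do rewrite has_word.
by apply: rec_negb; apply: (@rec_all_word (fun p n i => ~~ B p n i)) => //; recursive.
Qed.

(* [g = cpair k w] stands for the eventually constant point w_0 ... w_k w_k w_k ... *)
Definition seq_of (g i : nat) : nat := word_nth (csnd g) (minn i (cfst g)).
Definition lim_of (g : nat) : nat := word_nth (csnd g) (cfst g).
Definition prefix_code (r : baire) (k : nat) : nat := cpair k (wcode (mkseq r k.+1)).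

Lemma seq_of_prefix r k i : seq_of (prefix_code r k) i = r (minn i k).
Proof.
rewrite /seq_of /prefix_code cfstK csndK /word_nth /wcode CodeSeq.codeK nth_mkseq //.
by rewrite ltnS geq_minr.
Qed.

Lemma lim_of_prefix r k : lim_of (prefix_code r k) = r k.
Proof. by have := seq_of_prefix r k k; rewrite /seq_of /lim_of !cfstK minnn. Qed.

Lemma seq_of_lim g i : cfst g <= i -> seq_of g i = lim_of g.
Proof. by move=> h; rewrite /seq_of (minn_idPr h). Qed.

Lemma rec_seq_of f g : recursive f -> recursive g ->
  recursive (fun p n => seq_of (f p n) (g p n)).
Proof. by move=> hf hg; rewrite /seq_of /minn; recursive. Qed.

Lemma rec_lim_of f : recursive f -> recursive (fun p n => lim_of (f p n)).
Proof. by move=> hf; rewrite /lim_of; recursive. Qed.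

(** * Names of points and of pairs *)

Section HalfPowers.
Variable R : realType.
Implicit Types (e : R) (n : nat).
Local Open Scope ring_scope.

Lemma half_pow_gt0 n : 0 < 2 ^- n :> R.
Proof. by rewrite invr_gt0 exprn_gt0. Qed.

Lemma half_powS n : 2 ^- n = 2 * 2 ^- n.+1 :> R.
Proof. by rewrite exprS invfM mulrA divff ?mul1r // pnatr_eq0. Qed.

Lemma half_pow4 n : 2 ^- n = 16 * 2 ^- (n + 4) :> R.
Proof. by rewrite !addnS addn0 4!half_powS !mulrA; congr (_ * _); ring. Qed.

Lemma half_pow2 n : 2 ^- n = 4 * 2 ^- (n + 2) :> R.
Proof. by rewrite !addnS addn0 2!half_powS !mulrA; congr (_ * _); ring. Qed.

Lemma half_pow3 n : 2 ^- n = 8 * 2 ^- (n + 3) :> R.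
Proof. by rewrite !addnS addn0 3!half_powS !mulrA; congr (_ * _); ring. Qed.

Lemma half_pow_le m n : (m <= n)%N -> 2 ^- n <= 2 ^- m :> R.
Proof. by move=> mn; rewrite lef_pV2 ?posrE ?exprn_gt0 // ler_weXn2l // ler1n. Qed.

Lemma half_pow_lt e : 0 < e -> exists N, forall n, (N <= n)%N -> 2 ^- n < e.
Proof.
move=> e0; have [N] := @near_infty_natSinv_expn_lt R (PosNum e0).
move=> _ h; exists N => n /h /=; by rewrite div1r.
Qed.

End HalfPowers.

Section MetricNames.
Context {R : realType} {X : metricType R} (nu : nat -> X) (dq : nat -> nat).
Local Open Scope ring_scope.

Definition dist_code (i j s : nat) : nat := dq (cpair (cpair i j) s).

Hypothesis nu_dense : dense (range nu).
Hypothesis dist_codeP : forall i j k,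
  `|mdist (nu i) (nu j) - ratr (nuQ (dist_code i j k))| <= 2 ^- k.

Local Notation d x y := (mdist x y : R).

Lemma dist_code_le i j k : ratr (nuQ (dist_code i j k)) <= d (nu i) (nu j) + 2 ^- k.
Proof. by have := dist_codeP i j k; rewrite ler_norml => /andP[]; lra. Qed.

Lemma dist_code_ge i j k : d (nu i) (nu j) - 2 ^- k <= ratr (nuQ (dist_code i j k)).
Proof. by have := dist_codeP i j k; rewrite ler_norml => /andP[]; lra. Qed.

Lemma delta_X_dist p x i : delta_X nu p x -> d (nu (p i)) x <= 2 ^- i.
Proof.
move=> [px pC]; apply/ler_addgt0Pl => e e0.
have /cvgrPdist_lt/(_ e e0)[N _ hN] := px.
have /= := hN (maxn N i) (leq_maxl _ _); rewrite metric_sym => h.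
have := pC i (maxn N i); rewrite (minn_idPl (leq_maxr _ _)) => h'.
have := metric_triangle (nu (p i)) (nu (p (maxn N i))) x; lra.
Qed.

(** The two alternatives serve the two kinds of names below: rapidly converging ones and eventually
    constant ones. *)
Lemma delta_X_intro p x :
  (forall i j, (i < j)%N -> d (nu (p i)) (nu (p j)) < 2 ^- i) ->
  (forall i, d (nu (p i)) x <= 2 ^- i) \/ (exists N, forall i, (N <= i)%N -> nu (p i) = x) ->
  delta_X nu p x.
Proof.
move=> pC px; split.
  apply/cvgrPdist_lt => e e0; case: px => [px|[N hN]].
    have [N hN] := half_pow_lt e0; exists N => // n /= /hN; rewrite metric_sym.
    exact: le_lt_trans.
  by exists N => // n /= /hN ->; rewrite mdistxx.
move=> i j; case: (ltngtP i j) => [ij|ij|->].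
- exact: pC.
- by rewrite metric_sym; exact: pC.
- by rewrite mdistxx half_pow_gt0.
Qed.

(* Every prefix of a good name passes the decidable test [valid] below, which only
   sees distances up to an error, and [valid] in turn leaves room for the points
   near its limit to have a name with the same prefix, see [extend_name]. *)
Definition good_name (r : baire) (z : X) : Prop :=
  forall i, d (nu (r i)) z < 2 ^- (i + 4).

Lemma approx_point (z : X) (e : R) : 0 < e -> exists i, d (nu i) z < e.
Proof.
move=> e0; have [||w [/interior_subset + [i _ iw]]] := nu_dense (O := (ball z e)°).
- by exists z; exact: nbhsx_ballx.
- exact: open_interior.
- by rewrite -iw ballEmdist /= metric_sym; exists i.
Qed.

Lemma good_name_exists z : exists r, good_name r z.
Proof.
have h i : exists j, d (nu j) z < 2 ^- (i + 4) by apply/approx_point/half_pow_gt0.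
by have [r hr] := choice h; exists r.
Qed.

Lemma good_name_dist r z i j : good_name r z -> (i < j)%N ->
  d (nu (r i)) (nu (r j)) < 2 * 2 ^- (i + 4).
Proof.
move=> rz ij; have := rz i; have := rz j; rewrite [d (nu (r j)) z]metric_sym.
have := metric_triangle (nu (r i)) z (nu (r j)).
have : 2 ^- (j + 4) <= 2 ^- (i + 4) :> R by apply: half_pow_le; lia.
lra.
Qed.

Lemma good_name_delta_X r z : good_name r z -> delta_X nu r z.
Proof.
move=> rz; apply: delta_X_intro => [i j ij|].
  have := good_name_dist rz ij; have := half_pow4 R i; have := half_pow_gt0 R (i + 4).
  lra.
by left=> i; have := rz i; have := half_pow4 R i; have := half_pow_gt0 R (i + 4); lra.
Qed.

Definition valid (g : nat) : bool :=
  all (fun j => all (fun i =>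
    ~~ qlt 0 (dist_code (seq_of g i) (seq_of g j) (i + 4)) 1 i.+1) (iota 0 j))
  (iota 0 (cfst g).+1).

(** In units of 2^-(i + 4): the test accepts approximate distances up to 8 and the approximation
    errs by 1, while a Cauchy name tolerates anything below 16. Good names stay below 2 + 1, so they
    pass. *)
Lemma valid_dist g i j : valid g -> (i < j <= cfst g)%N ->
  d (nu (seq_of g i)) (nu (seq_of g j)) <= 9 * 2 ^- (i + 4).
Proof.
move=> vg /andP[ij jk]; move: vg => /allP/(_ j); rewrite mem_iota ltnS jk.
move=> /(_ isT)/allP/(_ i); rewrite mem_iota ij => /(_ isT).
rewrite (qltP R) nuQ0 add0r mul1r -leNgt.
have := dist_code_ge (seq_of g i) (seq_of g j) (i + 4).
have := half_pow4 R i; have := half_powS R i; lra.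
Qed.

Lemma valid_delta_X g : valid g -> delta_X nu (seq_of g) (nu (lim_of g)).
Proof.
move=> vg; apply: delta_X_intro; last by right; exists (cfst g) => i /seq_of_lim ->.
move=> i j ij; have [ki|ik] := leqP (cfst g) i.
  by rewrite !seq_of_lim ?mdistxx ?half_pow_gt0 //; exact: leq_trans (ltnW ij).
have -> : seq_of g j = seq_of g (minn j (cfst g)).
  by rewrite /seq_of -minnA minnn.
have := @valid_dist g i (minn j (cfst g)) vg; rewrite leq_min ij ik geq_minr.
move=> /(_ isT); have := half_pow4 R i; have := half_pow_gt0 R (i + 4); lra.
Qed.

Lemma valid_prefix r z k : good_name r z -> valid (prefix_code r k).
Proof.
move=> rz; apply/allP => j; rewrite mem_iota /= cfstK => jk.
apply/allP => i; rewrite mem_iota /= add0n => ij.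
rewrite (qltP R) nuQ0 add0r mul1r -leNgt !seq_of_prefix !(minn_idPl _); try lia.
have := dist_code_le (r i) (r j) (i + 4).
have := good_name_dist rz ij; have := half_pow4 R i; have := half_powS R i.
have := half_pow_gt0 R (i + 4); lra.
Qed.

(** The radius 2^-(k + 2), k = [cfst g], is large enough to capture the limit of a good name with
    this prefix, and small enough that a valid prefix extends to a name of any point of the ball. *)
Definition nbhd_code (g : nat) : nat :=
  cpair (lim_of g) (cpair 0 (2 ^ (cfst g + 2)).-1).

Lemma nbhd_codeP g z :
  alpha nu (nbhd_code g) z <-> d (nu (lim_of g)) z < 2 ^- (cfst g + 2).
Proof.
rewrite /alpha /nbhd_code ballEmdist cfstK csndK /nuQpos cfstK csndK /=.
by rewrite prednK ?expn_gt0 // fmorph_div rmorph1 rmorph_nat natrX div1r.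
Qed.

Lemma nbhd_code_prefix r z k : good_name r z -> alpha nu (nbhd_code (prefix_code r k)) z.
Proof.
move=> rz; apply/nbhd_codeP; rewrite lim_of_prefix cfstK.
apply: lt_le_trans (rz k) _; apply: half_pow_le; lia.
Qed.

Lemma extend_name g z : valid g -> alpha nu (nbhd_code g) z ->
  exists2 r, delta_X nu r z & forall i, (i <= cfst g)%N -> r i = seq_of g i.
Proof.
move=> vg /nbhd_codeP zg.
have /choice[c hc] i : exists j, d (nu j) z < 2 ^- (i + 3).
  by apply/approx_point/half_pow_gt0.
pose r i := if (i <= cfst g)%N then seq_of g i else c i.
(* In units of 2^-(i + 4): before the end of the prefix, 9 by validity plus at most 4 for the
   radius; at its end at most 4; afterwards 2. Passing to a later entry outside the prefix costs 1
   more, still below 16. *)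
have rz i : d (nu (r i)) z <= 13 * 2 ^- (i + 4).
  have p4 := half_pow_gt0 R (i + 4); have := half_pow4 R i.
  rewrite /r; case: leqP => [ik|_]; last by have := hc i; have := half_pow3 R i; lra.
  have : 2 ^- (cfst g + 2) <= 4 * 2 ^- (i + 4) :> R.
    have := half_pow_le R (leq_add ik (leqnn 2)).
    by have := half_pow4 R i; have := half_pow2 R i; lra.
  case: (ltngtP i (cfst g)) ik => // [ik _|ik _].
    have := @valid_dist g i (cfst g) vg; rewrite ik leqnn => /(_ isT).
    rewrite (seq_of_lim (leqnn _)).
    have := metric_triangle (nu (seq_of g i)) (nu (lim_of g)) z; lra.
  by move: p4; rewrite ik (seq_of_lim (leqnn _)); lra.
exists r; last by move=> i; rewrite /r => ->.
apply: delta_X_intro => [i j ij|]; last first.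
  left=> i; have := rz i; have := half_pow4 R i; have := half_pow_gt0 R (i + 4); lra.
have p4 := half_pow_gt0 R (i + 4); have e4 := half_pow4 R i.
have [jk|kj] := leqP j (cfst g).
  have ik : (i <= cfst g)%N by apply: leq_trans jk; exact: ltnW.
  have := @valid_dist g i j vg; rewrite ij jk => /(_ isT).
  rewrite /r ik jk; lra.
have h : d (nu (r j)) z < 2 ^- (j + 3) by rewrite /r leqNgt kj; exact: hc.
have : 2 ^- (j + 3) <= 2 ^- (i + 4) :> R by apply: half_pow_le; lia.
have := metric_triangle (nu (r i)) z (nu (r j)); rewrite [d z _]metric_sym.
have := rz i; lra.
Qed.

Definition pair_range (p q : baire) (n : nat) : nat :=
  (if cfst n == 0 then p (csnd n) else q (csnd n)).+1.

(* An associate of the distance function of {x, y}: entry <a, s> of the enumeration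
   is the rational a if it can be confirmed to be a lower bound from approximations
   that are wrong by at most 3 * 2^-s, and no entry otherwise. *)
Definition pair_dist (p q : baire) (c : nat) : nat :=
  if iter (csnd (word_nth c 0)).+1 word_tail c == 0 then 0 else
  (if qlt (cfst (word_nth c 0)) (dist_code (p (csnd (word_nth c 0)))
        (word_nth c (csnd (word_nth c 0)).+1) (csnd (word_nth c 0)))
        3 (csnd (word_nth c 0)) &&
      qlt (cfst (word_nth c 0)) (dist_code (q (csnd (word_nth c 0)))
        (word_nth c (csnd (word_nth c 0)).+1) (csnd (word_nth c 0)))
        3 (csnd (word_nth c 0))
   then (cfst (word_nth c 0)).+1 else 0).+1.

Definition pair_name (p q : baire) : baire := fun n =>
  if odd n then pair_dist p q n./2 else pair_range p q n./2.

(** Components and letters of a coded index do not exceed the index. This is what allows the names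
    of the two points to be cut off. *)
Lemma pair_name_local p q p' q' n :
  (forall i, (i <= n)%N -> p' i = p i) -> (forall i, (i <= n)%N -> q' i = q i) ->
  pair_name p' q' n = pair_name p q n.
Proof.
move=> pp qq; have n2 : (n./2 <= n)%N by lia.
rewrite /pair_name /pair_dist /pair_range.
have h1 : (csnd n./2 <= n)%N by apply: leq_trans (leq_csnd _) _.
have h2 : (csnd (word_nth n./2 0) <= n)%N.
  apply: leq_trans (leq_csnd _) _; apply: leq_trans n2; rewrite /word_nth.
  have := CodeSeq.gtn_decode n./2; case: (CodeSeq.decode _) => //= a l /andP[/ltnW //].
by rewrite !pp ?qq.
Qed.

(** The answer is withheld until the word contains entry [csnd n] of [r], the only one consulted. *)
Lemma pair_dist_word p q n r k :
  pair_dist p q (wcode (n :: mkseq r k)) =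
  if (k <= csnd n)%N then 0%N else
  (if qlt (cfst n) (dist_code (p (csnd n)) (r (csnd n)) (csnd n)) 3 (csnd n) &&
      qlt (cfst n) (dist_code (q (csnd n)) (r (csnd n)) (csnd n)) 3 (csnd n)
   then (cfst n).+1 else 0).+1.
Proof.
rewrite /pair_dist -[_ == 0%N]negbK word_size_gt /word_nth /wcode CodeSeq.codeK /=.
rewrite size_mkseq ltnS -leqNgt; case: leqP => // kn.
by rewrite nth_mkseq.
Qed.

Lemma pair_testP p x r z a s : delta_X nu p x -> delta_X nu r z ->
  qlt a (dist_code (p s) (r s) s) 3 s -> ratr (nuQ a) < d x z.
Proof.
move=> px rz; rewrite (qltP R).
have := dist_code_le (p s) (r s) s.
have := delta_X_dist s px; have := delta_X_dist s rz.
have := metric_triangle (nu (p s)) x (nu (r s)).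
have := metric_triangle x z (nu (r s)); rewrite [d z _]metric_sym.
lra.
Qed.

Lemma pair_test_ex p x r z a : delta_X nu p x -> delta_X nu r z ->
  ratr (nuQ a) < d x z ->
  exists N, forall s, (N <= s)%N -> qlt a (dist_code (p s) (r s) s) 3 s.
Proof.
move=> px rz; rewrite -subr_gt0 => h.
have h' : 0 < (d x z - ratr (nuQ a)) / 6 by apply: divr_gt0.
have [N hN] := half_pow_lt h'; exists N => s /hN; rewrite (qltP R).
have := dist_code_ge (p s) (r s) s.
have := delta_X_dist s px; have := delta_X_dist s rz.
have := metric_triangle x (nu (p s)) z; rewrite [d x (nu _)]metric_sym.
have := metric_triangle (nu (p s)) (nu (r s)) z.
lra.
Qed.

Lemma dist_to_pair (x y z : X) (t : R) :
  (t%:E < dist_to [set x; y] z)%E <-> t < d x z /\ t < d y z.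
Proof.
have -> : dist_to [set x; y] z = (Num.min (d x z) (d y z))%:E.
  rewrite /dist_to; apply/eqP; rewrite eq_le; apply/andP; split.
    rewrite minEle; case: ifP => _; apply: ereal_inf_lbound.
      by exists x; [left|rewrite metric_sym].
    by exists y; [right|rewrite metric_sym].
  apply: le_ereal_inf_tmp => _ [w /= [->|->] <-];
    by rewrite lee_fin [mdist z _]metric_sym ge_min lexx ?orbT.
by rewrite lte_fin lt_min; split => /andP.
Qed.

Lemma pair_nameP p q x y : delta_X nu p x -> delta_X nu q y ->
  rep_meet (delta_range nu) (delta_dist_gt nu) (pair_name p q) [set x; y].
Proof.
move=> px qy.
have cl : closed [set x; y].
  by apply: closedU; apply: accessible_closed_set1; apply: hausdorff_accessible;
     apply: metric_hausdorff.
have e0 n : bproj 0 (pair_name p q) n = pair_range p q n.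
  by rewrite /bproj /pair_name addn0 odd_double doubleK.
have e1 n : bproj 1 (pair_name p q) n = pair_dist p q n.
  by rewrite /bproj /pair_name addn1 /= odd_double /= uphalf_double.
split; split => //.
  right; split; first by exists x; left.
    by move=> i j; rewrite /bcomp e0.
  exists (fun i => if i == 0%N then x else y); split.
    move=> i; split; first by case: ifP => _; [left|right].
    have -> : (fun j => (bcomp i (bproj 0 (pair_name p q)) j).-1) = if i == 0%N then p else q.
      by apply/funext => j; rewrite /bcomp e0 /pair_range cfstK csndK; case: ifP.
    by case: ifP.
  by move=> _ /= [->|->]; apply: subset_closure; [exists 0%N|exists 1%N].
move=> r z rz _.
exists (fun n => if qlt (cfst n) (dist_code (p (csnd n)) (r (csnd n)) (csnd n)) 3 (csnd n) &&
      qlt (cfst n) (dist_code (q (csnd n)) (r (csnd n)) (csnd n)) 3 (csnd n)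
   then (cfst n).+1 else 0%N); split.
  move=> n; exists (csnd n).+1; rewrite e1 pair_dist_word ltnn; split => // j.
  by rewrite ltnS e1 pair_dist_word => ->.
exists (dist_to [set x; y] z); split => //; apply/seteqP; split => a /=.
  move=> /dist_to_pair[hx hy].
  have [N1 h1] := pair_test_ex px rz hx; have [N2 h2] := pair_test_ex qy rz hy.
  by exists (cpair a (maxn N1 N2)); rewrite /= cfstK csndK h1 ?leq_maxl // h2 ?leq_maxr.
move=> [n /=]; case: ifP => // /andP[h1 h2] _ <- /=; apply/dist_to_pair.
by split; [exact: pair_testP h1|exact: pair_testP h2].
Qed.

End MetricNames.

(** * Retractions onto pairs *)

(* [c] may diverge where [b] fails: the recursion then makes no step and never
   calls it. *)
Lemma rec_lazy_if (b : baire -> nat -> bool) F c : recursive (fun p n => b p n) ->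
  (forall p n, b p n -> eval p c n (F p n)) ->
  recursive (fun p n => if b p n then F p n else 0).
Proof.
move=> [cb hb] hc; exists (Comp (Rec Zero (Comp c Fst)) (Pair (Pair Fst Snd) cb)) => p n.
exists (cpair n (b p n)); split.
  by exists n, (b p n); split => //; exists (cfst n), (csnd n); rewrite cpairK.
exists (fun i => if i is 0 then 0 else F p n); rewrite csndK cfstK; split => //.
  case bpn: (b p n) => // -[] // _; exists n; split; first by rewrite /= cfstK.
  exact: hc.
by case: (b p n).
Qed.

(** A bounded run of [eta]: the associate is queried on prefixes of length below [k] only, and 0
    means that it has not answered yet. *)
Definition first_answer (P : baire) (t : nat) (r : baire) (k : nat) : nat :=
  iteri k (fun j v => if v == 0 then P (wcode (t :: mkseq r j)) else v) 0.

Lemma first_answerE P t r K m k : P (wcode (t :: mkseq r K)) = m.+1 ->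
  (forall j, j < K -> P (wcode (t :: mkseq r j)) = 0) ->
  first_answer P t r k = if K < k then m.+1 else 0.
Proof.
move=> hK h0; elim: k => // k IH.
rewrite /first_answer /= -/(first_answer P t r k) IH ltnS.
by case: ltngtP => [//|/h0 ->|<-].
Qed.

Lemma first_answer_eta P t r s k : eta P r s ->
  first_answer P t r k != 0 -> first_answer P t r k = (s t).+1.
Proof. by move=> /(_ t)[K [hK h0]]; rewrite (first_answerE k hK h0); case: ifP. Qed.

Lemma first_answer_ex P t r s : eta P r s ->
  exists K, forall k, K <= k -> first_answer P t r k = (s t).+1.
Proof.
by move=> /(_ t)[K [hK h0]]; exists K.+1 => k Kk; rewrite (first_answerE k hK h0) Kk.
Qed.

Lemma first_answer_local P t r r' k : (forall i, i.+1 < k -> r i = r' i) ->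
  first_answer P t r k = first_answer P t r' k.
Proof.
elim: k => // k IH h; rewrite /first_answer /= -!/(first_answer P t _ k) IH.
  case: ifP => // _; congr (P (wcode (_ :: _))).
  by apply/eq_in_map => i; rewrite mem_iota => ik; apply: h.
by move=> i ik; apply: h; exact: ltnW.
Qed.

Lemma rec_first_answer (P r : baire -> nat -> nat -> nat) t k :
  recursive (fun p a => P p (cfst a) (csnd a)) ->
  recursive (fun p a => r p (cfst a) (csnd a)) -> recursive t -> recursive k ->
  recursive (fun p n => first_answer (P p n) (t p n) (r p n) (k p n)).
Proof.
move=> hP hr ht hk; rewrite /first_answer; recursive.
apply: (rec2 (h := P)) => //; recursive.
rewrite /wcode /= -/(wcode _); recursive.
  by apply: (rec_subst ht); recursive.
by apply: (rec2 (h := r)); recursive.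
Qed.

Lemma rep_funP (T U : Type) (d : rep T) (d' : rep U) P (f : T -> U) r z :
  rep_fun d d' P f -> d r z -> exists2 s, eta P r s & d' s (f z).
Proof. by move=> hf /hf /(_ I)[s [es [w [sw wE]]]]; exists s => //; rewrite -wE. Qed.

Section Retractions.
Context {R : realType} {X : metricType R} (nu : nat -> X) (dq : nat -> nat).
Hypothesis nu_dense : dense (range nu).
Hypothesis dist_codeP : forall i j k,
  (`|mdist (nu i) (nu j) - ratr (nuQ (dist_code dq i j k))| <= 2 ^- k)%R.
Hypothesis dq_computable : computable_point dq.
Local Notation d x y := (mdist x y : R).

Lemma rec_dist_code i j k : recursive i -> recursive j -> recursive k ->
  recursive (fun p n => dist_code dq (i p n) (j p n) (k p n)).
Proof. by move=> *; apply: rec_point => //; recursive. Qed.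

Lemma rec_valid f : recursive f -> recursive (fun p n => valid dq (f p n)).
Proof.
move=> hf; apply: (rec_subst (h := fun _ n => nat_of_bool (valid dq n))) => //.
by rewrite /valid; recursive; apply: rec_dist_code; recursive; apply: rec_seq_of; recursive.
Qed.

Lemma rec_pair_name (f g : baire -> nat -> nat -> nat) n :
  recursive (fun p a => f p (cfst a) (csnd a)) ->
  recursive (fun p a => g p (cfst a) (csnd a)) -> recursive n ->
  recursive (fun p a => pair_name dq (f p a) (g p a) (n p a)).
Proof.
move=> hf hg hn; rewrite /pair_name /pair_dist /pair_range.
have hf' u v : recursive u -> recursive v -> recursive (fun p a => f p (u p a) (v p a)).
  exact: (rec2 (h := f)).
have hg' u v : recursive u -> recursive v -> recursive (fun p a => g p (u p a) (v p a)).
  exact: (rec2 (h := g)).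
by recursive; (try apply: rec_dist_code); recursive; (apply: hf' || apply: hg'); recursive.
Qed.

Lemma rec_nbhd_code f : recursive f -> recursive (fun p n => nbhd_code (f p n)).
Proof. by move=> hf; rewrite /nbhd_code; recursive; apply: rec_lim_of. Qed.

(** A program realising the operation E, used only on names of sets {x, y}; its output [P] is an
    associate of a retraction onto {x, y}. *)
Variable cF : prog.
Hypothesis cFP : forall p q x y, delta_X nu p x -> delta_X nu q y ->
  exists P, (forall n, eval (pair_name dq p q) cF n (P n)) /\
  exists f, rep_fun (delta_X nu) (delta_X nu) P f /\ op_E [set x; y] f.

Definition valid_pair (e : nat) : bool := valid dq (cfst e) && valid dq (csnd e).
Local Notation pt g := (nu (lim_of g)).

Definition retraction_family (P : nat -> nat -> nat) (f : nat -> X -> X) : Prop :=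
  forall e, valid_pair e ->
  [/\ forall n, eval (pair_name dq (seq_of (cfst e)) (seq_of (csnd e))) cF n (P e n),
      rep_fun (delta_X nu) (delta_X nu) (P e) (f e) &
      op_E [set pt (cfst e); pt (csnd e)] (f e)].

(** Although picked by choice, the associates are recursive: on valid codes they are the outputs of
    [cF], and on invalid ones, where [cF] may diverge, they are set to 0 after a decidable test. *)
Lemma retraction_family_exists : exists P f,
  recursive (fun _ n => P (cfst n) (csnd n)) /\ retraction_family P f.
Proof.
have h e : exists Pf : (nat -> nat) * (X -> X), valid_pair e ->
  [/\ forall n, eval (pair_name dq (seq_of (cfst e)) (seq_of (csnd e))) cF n (Pf.1 n),
      rep_fun (delta_X nu) (delta_X nu) Pf.1 Pf.2 &
      op_E [set pt (cfst e); pt (csnd e)] Pf.2].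
  case v: (valid_pair e); last by exists (id, id).
  move: v => /andP[v1 v2].
  have [P [P1 [f [f1 f2]]]] := cFP (valid_delta_X dist_codeP v1) (valid_delta_X dist_codeP v2).
  by exists (P, f).
have {h}[Pf hPf] := choice h.
exists (fun e n => if valid_pair e then (Pf e).1 n else 0), (fun e => (Pf e).2); split.
  have [g hg] : recursive (fun _ m =>
      pair_name dq (seq_of (cfst (cfst m))) (seq_of (csnd (cfst m))) (csnd m)).
    by apply: (rec_pair_name (f := fun p m => seq_of (cfst (cfst m)))
         (g := fun p m => seq_of (csnd (cfst m)))); recursive; apply: rec_seq_of; recursive.
  apply: (rec_lazy_if (c := oracle_subst g cF)).
    by rewrite /valid_pair; recursive; apply: rec_valid; recursive.
  move=> p n /hPf[hP _ _]; rewrite -[n in eval _ _ n]cpairK.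
  apply: eval_oracle_subst (hP (csnd n)) => i.
  by have := hg p (cpair (cfst n) i); rewrite cfstK csndK.
by move=> e ve; rewrite ve; exact: hPf.
Qed.

Variables (P : nat -> nat -> nat) (f : nat -> X -> X).
Hypothesis P_rec : recursive (fun _ n => P (cfst n) (csnd n)).
Hypothesis Pf : retraction_family P f.

Lemma retraction_pair e z : valid_pair e -> f e z = pt (cfst e) \/ f e z = pt (csnd e).
Proof. by move=> /Pf[_ _ [_ + _]] => fA; have : range (f e) (f e z) by []; rewrite fA. Qed.

(** The bound [(cfst g).+2] admits prefixes of length up to [(cfst g).+1], which are exactly those
    shared by all names extending [g]. *)
Definition avoid_answer (e t g : nat) : nat :=
  first_answer (P e) t (seq_of g) (cfst g).+2.

(* Confirms that [f e] omits the point coded by [c] on the ball [nbhd_code g]. As the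
   values of [f e] lie in a pair, omitting one of its points decides the value. *)
Definition avoids (e c t g : nat) : bool :=
  [&& valid_pair e, valid dq g, avoid_answer e t g != 0 &
      qlt 0 (dist_code dq (avoid_answer e t g).-1 (lim_of c) t) 2 t].

(** Each point of the ball has a name beginning with the prefix [g], so the answer read from [g] is
    entry [t] of a name of its image, hence within 2^-t of it. The margin 2 covers this error and
    that of [dist_code]. *)
Lemma avoidsP e c t g z : avoids e c t g -> alpha nu (nbhd_code g) z -> f e z <> pt c.
Proof.
move=> /and4P[/Pf[_ hf _] vg a0 hq] zg fz.
have [r rz rg] := extend_name nu_dense dist_codeP vg zg.
have [s es sy] := rep_funP hf rz.
move: a0 hq; rewrite /avoid_answer.
rewrite -(@first_answer_local (P e) t r); last by move=> i; rewrite !ltnS; exact: rg.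
move=> /(first_answer_eta es) aE; rewrite aE /= (qltP R) nuQ0 add0r.
rewrite ltNge => /negP; apply.
have := delta_X_dist t sy; rewrite fz; have := dist_code_le dist_codeP (s t) (lim_of c) t.
by rewrite mulr_natl mulr2n; lra.
Qed.

Lemma avoids_ex e c r z : valid_pair e -> good_name nu r z -> f e z <> pt c ->
  exists T, forall t, T <= t -> exists K, forall k, K <= k ->
    avoids e c t (prefix_code r k).
Proof.
move=> ve rz fz; have [_ hf _] := Pf ve.
have [s es sy] := rep_funP hf (good_name_delta_X rz).
(* Two errors of 2^-t plus the margin 2 of the test. *)
have d0 : (0 < d (f e z) (pt c) / 4)%R by rewrite divr_gt0 // mdist_gt0; apply/eqP.
have [T hT] := half_pow_lt d0; exists T => t /hT tT.
have [K hK] := first_answer_ex t es; exists K => k Kk.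
have E : avoid_answer e t (prefix_code r k) = (s t).+1.
  rewrite /avoid_answer cfstK -(hK k.+2); last by lia.
  apply: first_answer_local => i; rewrite !ltnS seq_of_prefix => ik.
  by rewrite (minn_idPl ik).
rewrite /avoids ve (valid_prefix dist_codeP k rz) E /= (qltP R) nuQ0 add0r.
have := delta_X_dist t sy; have := dist_code_ge dist_codeP (s t) (lim_of c) t.
have := metric_triangle (f e z) (nu (s t)) (pt c).
rewrite [d (f e z) (nu (s t))]metric_sym; lra.
Qed.

Lemma eta_agree Q Q' r s s' t J :
  (forall j, j <= J -> Q (wcode (t :: mkseq r j)) = Q' (wcode (t :: mkseq r j))) ->
  Q (wcode (t :: mkseq r J)) = (s t).+1 ->
  (forall j, j < J -> Q (wcode (t :: mkseq r j)) = 0) ->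
  eta Q' r s' -> s' t = s t.
Proof.
move=> QQ hJ h0 /(_ t)[J' [hJ' h0']].
case: (ltngtP J' J) => [lt|lt|eq].
- by have := h0 _ lt; rewrite QQ ?hJ' // ltnW.
- by have := h0' _ lt; rewrite -QQ ?hJ.
- by move: hJ'; rewrite eq -QQ // hJ => -[].
Qed.

Lemma separating_pair x y : x <> y ->
  exists e, [/\ valid_pair e, f e x <> pt (csnd e) & f e y <> pt (cfst e)].
Proof.
move=> xy.
have [p px] := good_name_exists nu_dense x; have [q qy] := good_name_exists nu_dense y.
have [Q [hQ [h [hQh [_ _ hid]]]]] := cFP (good_name_delta_X px) (good_name_delta_X qy).
(* If the truncated retraction sent x to the point near y, then x and y would be joined by three
   steps of length at most 2^-t. *)
have d0 : (0 < d x y / 3)%R by rewrite divr_gt0 // mdist_gt0; apply/eqP.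
have [t /(_ t (leqnn _)) ht] := half_pow_lt d0.
have [s es] := rep_funP hQh (good_name_delta_X px); rewrite hid; last by left.
move=> sx.
have [s' es'] := rep_funP hQh (good_name_delta_X qy); rewrite hid; last by right.
move=> sy.
have [J [hJ h0]] := es t; have [J' [hJ' h0']] := es' t.
(* [N] bounds the codes of all words on which the associate [Q] is queried before it yields entry
   [t] at [p] and at [q]. *)
pose N := maxn (\max_(j < J.+1) wcode (t :: mkseq p j))
  (\max_(j < J'.+1) wcode (t :: mkseq q j)).
(* By the use principle, finitely many entries of the name of {x, y} determine [Q] up to [N]. *)
have [L hL] : exists L, forall o, (forall i, i < L -> o i = pair_name dq p q i) ->
    forall n, n <= N -> eval o cF n (Q n).
  elim: N => [|N [L hL]].
    by have [L hL] := eval_use (hQ 0); exists L => o /hL ? [].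
  have [L' hL'] := eval_use (hQ N.+1); exists (maxn L L') => o ho n.
  rewrite leq_eqVlt => /orP[/eqP ->|]; [apply: hL'|rewrite ltnS; apply: hL];
    by move=> i iL; apply: ho; rewrite leq_max iL ?orbT.
(* Cutting at [k >= L] preserves these entries, and [k >= t] puts the cut-off points within 2^-t of
   x and y. *)
pose k := maxn L t; pose e := cpair (prefix_code p k) (prefix_code q k).
have ve : valid_pair e.
  by rewrite /valid_pair cfstK csndK (valid_prefix dist_codeP k px)
    (valid_prefix dist_codeP k qy).
have [hP hf _] := Pf ve.
have PQ n : n <= N -> Q n = P e n.
  move=> nN; apply: eval_functional (hP n); apply: hL => // i iL.
  rewrite cfstK csndK; apply: pair_name_local => j ji;
    rewrite seq_of_prefix (minn_idPl _) //; by rewrite /k; lia.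
have [u eu ux] := rep_funP hf (good_name_delta_X px).
have [u' eu' uy] := rep_funP hf (good_name_delta_X qy).
have us : u t = s t.
  apply: (eta_agree _ hJ h0 eu) => j jJ; apply: PQ; rewrite leq_max; apply/orP; left.
  exact: (@leq_bigmax _ (fun j : 'I_J.+1 => wcode (t :: mkseq p j)) (Ordinal (jJ : j < J.+1))).
have us' : u' t = s' t.
  apply: (eta_agree _ hJ' h0' eu') => j jJ; apply: PQ; rewrite leq_max; apply/orP; right.
  exact: (@leq_bigmax _ (fun j : 'I_J'.+1 => wcode (t :: mkseq q j)) (Ordinal (jJ : j < J'.+1))).
have tk : (2 ^- k <= 2 ^- t :> R)%R by apply: half_pow_le; rewrite leq_maxr.
exists e; rewrite cfstK csndK !lim_of_prefix; split => //.
  move=> fx; have := delta_X_dist t sx; have := delta_X_dist t ux; rewrite us fx.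
  have := delta_X_dist k (good_name_delta_X qy).
  have := metric_triangle x (nu (s t)) y; have := metric_triangle (nu (s t)) (nu (q k)) y.
  rewrite [d x (nu _)]metric_sym; lra.
move=> fy; have := delta_X_dist t sy; have := delta_X_dist t uy; rewrite us' fy.
have := delta_X_dist k (good_name_delta_X px).
have := metric_triangle y (nu (s' t)) x; have := metric_triangle (nu (s' t)) (nu (p k)) x.
rewrite [d y x]metric_sym [d y (nu _)]metric_sym; lra.
Qed.

Lemma rec_P e n : recursive e -> recursive n -> recursive (fun p a => P (e p a) (n p a)).
Proof. exact: (rec2 (h := fun _ => P)). Qed.

Lemma rec_avoids e c t g : recursive e -> recursive c -> recursive t -> recursive g ->
  recursive (fun p n => avoids (e p n) (c p n) (t p n) (g p n)).
Proof.
move=> he hc ht hg.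
have hV : recursive (fun p n => avoid_answer (e p n) (t p n) (g p n)).
  apply: (rec_first_answer (P := fun p n => P (e p n)) (r := fun p n => seq_of (g p n)));
    recursive; [apply: rec_P|apply: rec_seq_of]; recursive.
  - by apply: (rec_subst he); recursive.
  - by apply: (rec_subst hg); recursive.
rewrite /avoids /valid_pair; recursive; try (apply: rec_valid; recursive).
by apply: rec_dist_code; recursive; apply: rec_lim_of.
Qed.

End Retractions.

(** * The search for a clopen neighbourhood *)

Section OpenSets.
Context {R : realType} {X : metricType R} (nu : nat -> X).
Hypothesis nu_dense : dense (range nu).
Local Open Scope ring_scope.

Lemma alpha_open n : open (alpha nu n).
Proof.
rewrite openE /interior => x; rewrite /alpha ballEmdist /= => xn.
apply/nbhs_mdistP; exists (ratr (nuQpos (csnd n)) - mdist (nu (cfst n)) x).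
  by rewrite /= subr_gt0.
move=> y /= xy; have := metric_triangle (nu (cfst n)) x y; lra.
Qed.

Lemma alpha_basis (U : set X) x : open U -> U x ->
  exists2 n, alpha nu n x & alpha nu n `<=` U.
Proof.
rewrite openE => /[apply] /nbhs_mdistP[e /= e0 eU].
have [N /(_ (N + 1)%N (leq_addr _ _))] := half_pow_lt e0.
move=> Ne; set h := 2 ^- (N + 2) : R.
have h0 : 0 < h by exact: half_pow_gt0.
have he : 2 * h < e by rewrite /h addn2 -half_powS -[N.+1]addn1.
have [i hi] := approx_point nu_dense x h0.
(* A constant prefix, so that [nbhd_code] yields the ball of radius [h] about [nu i]. *)
pose g := cpair N (wcode (nseq N.+1 i)).
have lg : lim_of g = i.
  by rewrite /lim_of /g cfstK csndK /word_nth /wcode CodeSeq.codeK nth_nseq ltnSn.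
exists (nbhd_code g); first by apply/nbhd_codeP; rewrite lg cfstK.
move=> y /nbhd_codeP; rewrite lg cfstK -/h => hy; apply: eU => /=.
have := metric_triangle x (nu i) y; rewrite [mdist x (nu i)]metric_sym; lra.
Qed.

Lemma delta_Sigma_open p U : delta_Sigma nu p U -> open U.
Proof. by move=> ->; apply: bigcup_open => i _; exact: alpha_open. Qed.

(** Realisers act on names, so each open set must be given one: the list of all basic balls inside
    it, which need not be computable. *)
Lemma delta_Sigma_surj U : open U -> exists p, delta_Sigma nu p U.
Proof.
move=> oU; exists (fun n => if `[< alpha nu n `<=` U >] then n.+1 else 0%N).
apply/seteqP; split => [x /(alpha_basis oU)[n nx nU]|x [n /=]].
  by exists n; rewrite /=; have /asboolP -> := nU.
by case: asboolP => // h _ /= /h.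
Qed.

End OpenSets.

Section Search.
Context {R : realType} {X : metricType R} (nu : nat -> X) (dq : nat -> nat).
Hypothesis nu_dense : dense (range nu).
Hypothesis dist_codeP : forall i j k,
  (`|mdist (nu i) (nu j) - ratr (nuQ (dist_code dq i j k))| <= 2 ^- k)%R.
Hypothesis dq_computable : computable_point dq.
Variable pc : baire.
Hypothesis pc_computable : computable_point pc.
Hypothesis pcP : delta_cover nu pc [set: X].
Variable cF : prog.
Hypothesis cFP : forall p q x y, delta_X nu p x -> delta_X nu q y ->
  exists P, (forall n, eval (pair_name dq p q) cF n (P n)) /\
  exists f, rep_fun (delta_X nu) (delta_X nu) P f /\ op_E [set x; y] f.
Variables (P : nat -> nat -> nat) (f : nat -> X -> X).
Hypothesis P_rec : recursive (fun _ n => P (cfst n) (csnd n)).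
Hypothesis Pf : retraction_family nu dq cF P f.
Local Notation d x y := (mdist x y : R).
Local Notation pt g := (nu (lim_of g)).
Local Notation avoids := (avoids dq P).

(** The finite intersections of clopen sets, phrased by avoidance because that is what [avoids]
    confirms. For valid [e] the condition forces the value [pt (cfst e)]. *)
Definition cell (J : nat) : set X :=
  [set z | forall e, e \in CodeSeq.decode J -> f e z <> pt (csnd e)].

Definition all_avoid (J t g : nat) : bool :=
  all (fun e => avoids e (csnd e) t g) (CodeSeq.decode J).

(** The rational coded here is the radius of [nbhd_code g]; the margin 2 covers the error of [r s]
    and that of [dist_code]. *)
Definition in_nbhd (r : baire) (g s : nat) : bool :=
  qlt (dist_code dq (r s) (lim_of g) s) (cpair (cpair 1 0) (2 ^ (cfst g + 2)).-1) 2 s.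

(** Confirms that ball [n] misses the cell: on it some retraction of [J] omits its first point,
    hence takes the second. *)
Definition outside_ball (J s n : nat) : bool :=
  has (fun e => has (fun l => avoids e (cfst e) (cfst l) (csnd l) &&
    (nbhd_code (csnd l) == n)) (iota 0 s)) (CodeSeq.decode J).

(** If the balls of [w] cover X, this shows that the cell lies in the open set named by [u]: every
    ball is listed in [u] or misses the cell. *)
Definition covered (u : baire) (J s w : nat) : bool :=
  all (fun n => has (fun l => u l == n.+1) (iota 0 s) || outside_ball J s n)
    (CodeSeq.decode w).

Definition witness (p : baire) (J t g s i : nat) : bool :=
  [&& all_avoid J t g, in_nbhd (bproj 0 p) g s & covered (bproj 1 p) J s (pc i)].

(** Even entries list balls confirmed to lie in the cell, odd entries balls confirmed to miss it. *)
Definition cell_name (J i : nat) : nat :=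
  if odd i then
    let e := cfst i./2 in
    let l := csnd i./2 in
    if has (fun e' => e' == e) (CodeSeq.decode J) && avoids e (cfst e) (cfst l) (csnd l)
    then (nbhd_code (csnd l)).+1 else 0
  else if all_avoid J (cfst i./2) (csnd i./2) then (nbhd_code (csnd i./2)).+1 else 0.

Lemma in_nbhdP r g s x : delta_X nu r x -> in_nbhd r g s -> alpha nu (nbhd_code g) x.
Proof.
move=> rx; rewrite /in_nbhd (qltP R) => h; apply/nbhd_codeP; move: h.
rewrite nuQ_half_pow.
have := dist_code_ge dist_codeP (r s) (lim_of g) s; have := delta_X_dist s rx.
have := metric_triangle (pt g) (nu (r s)) x; rewrite [d (pt g) (nu (r s))]metric_sym.
lra.
Qed.

Lemma in_nbhd_ex r g x : delta_X nu r x -> alpha nu (nbhd_code g) x ->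
  exists S, forall s, S <= s -> in_nbhd r g s.
Proof.
move=> rx /nbhd_codeP; rewrite -subr_gt0 => h.
have h' : (0 < (2 ^- (cfst g + 2) - d (pt g) x) / 4)%R by rewrite divr_gt0.
have [S hS] := half_pow_lt h'; exists S => s /hS.
rewrite /in_nbhd (qltP R) nuQ_half_pow.
have := dist_code_le dist_codeP (r s) (lim_of g) s; have := delta_X_dist s rx.
have := metric_triangle (nu (r s)) x (pt g); rewrite [d x (pt g)]metric_sym.
lra.
Qed.

(** If the two points of a pair coincided, the retraction would always take the forbidden value and
    the cell would be empty. *)
Lemma nondegenerate J e z : cell J z -> e \in CodeSeq.decode J -> valid_pair dq e ->
  f e z = pt (cfst e) /\ pt (cfst e) <> pt (csnd e).
Proof.
move=> Jz eJ ve; have := Jz _ eJ; case: (retraction_pair Pf z ve) => -> //.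
Qed.

Lemma all_avoid_cell J t g z : all_avoid J t g -> alpha nu (nbhd_code g) z -> cell J z.
Proof.
by move=> /allP h zg e eJ; exact: (avoidsP nu_dense dist_codeP Pf (h e eJ) zg).
Qed.

Lemma all_avoid_ex (s : seq nat) r z : good_name nu r z ->
  (forall e, e \in s -> valid_pair dq e /\ f e z <> pt (csnd e)) ->
  exists T, forall t, T <= t -> exists K, forall k, K <= k ->
    all (fun e => avoids e (csnd e) t (prefix_code r k)) s.
Proof.
move=> rz; elim: s => [|e s IH] h; first by exists 0 => t _; exists 0.
have [T1 h1] := IH (fun e' es => h e' (mem_behead (s := e :: s) es)).
have [ve fe] := h e (mem_head e s).
have [T2 h2] := avoids_ex dist_codeP Pf ve rz fe.
exists (maxn T1 T2) => t; rewrite geq_max => /andP[/h1[K1 k1] /h2[K2 k2]].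
by exists (maxn K1 K2) => k; rewrite geq_max => /andP[/k1 /= -> /k2 ->].
Qed.

Section Soundness.
Variables (J : nat) (x0 : X).
Hypothesis J_valid : forall e, e \in CodeSeq.decode J -> valid_pair dq e.
Hypothesis Jx0 : cell J x0.

Lemma avoid_point_compl e l z : e \in CodeSeq.decode J ->
  avoids e (cfst e) (cfst l) (csnd l) -> alpha nu (nbhd_code (csnd l)) z -> ~ cell J z.
Proof.
move=> eJ ae zl /(_ e eJ); case: (retraction_pair Pf z (J_valid eJ)) => // fz _.
exact: (avoidsP nu_dense dist_codeP Pf ae zl).
Qed.

Lemma cell_nameP : delta_Delta nu (cell_name J) (cell J).
Proof.
have e0 n : bproj 0 (cell_name J) n =
    if all_avoid J (cfst n) (csnd n) then (nbhd_code (csnd n)).+1 else 0.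
  by rewrite /bproj /cell_name addn0 odd_double doubleK.
have e1 n : bproj 1 (cell_name J) n =
    if has (fun e' => e' == cfst n) (CodeSeq.decode J) &&
       avoids (cfst n) (cfst (cfst n)) (cfst (csnd n)) (csnd (csnd n))
    then (nbhd_code (csnd (csnd n))).+1 else 0.
  by rewrite /bproj /cell_name addn1 /= odd_double /= uphalf_double.
split; apply/seteqP; split => z.
- move=> Jz; have [r rz] := good_name_exists nu_dense z.
  have [T /(_ T (leqnn _))[K /(_ K (leqnn _)) hK]] :=
    all_avoid_ex rz (fun e eJ => conj (J_valid eJ) (Jz e eJ)).
  exists (cpair T (prefix_code r K)); rewrite /= e0 cfstK csndK /all_avoid hK //.
  exact: nbhd_code_prefix.
- by move=> [n /=]; rewrite e0; case: ifP => // h _; exact: (all_avoid_cell h).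
- move=> /= /existsNP[e /not_implyP[eJ /contrapT fz]].
  (* The value at [z] is the second point; it differs from the first because the cell contains [x0],
     so avoidance of the first can be confirmed. *)
  have [_ ne] := nondegenerate Jx0 eJ (J_valid eJ).
  have [r rz] := good_name_exists nu_dense z.
  have fz' : f e z <> pt (cfst e) by rewrite fz => /esym.
  have [T /(_ T (leqnn _))[K /(_ K (leqnn _)) hK]] :=
    avoids_ex dist_codeP Pf (J_valid eJ) rz fz'.
  exists (cpair e (cpair T (prefix_code r K)));
    rewrite /= e1 !(cfstK, csndK) hK has_pred1 eJ //.
  exact: nbhd_code_prefix.
- move=> [n /=]; rewrite e1; case: ifP => // /andP[]; rewrite has_pred1 => eJ h _ /=.
  exact: avoid_point_compl eJ h.
Qed.

Lemma covered_sub u U s i : delta_Sigma nu u U -> covered u J s (pc i) -> cell J `<=` U.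
Proof.
move=> uU cov z Jz; have [_ rpc] := pcP.
have [w wX wi] : [set wcode w | w in [set w : seq nat |
    [set: X] `<=` \bigcup_(n in [set` w]) alpha nu n]] (pc i) by rewrite -rpc; exists i.
have [n /= nw zn] := wX z I; move: cov; rewrite /covered -wi /wcode CodeSeq.codeK.
move=> /allP/(_ n nw)/orP[/hasP[l _ /eqP ul]|].
  by rewrite uU; exists l; rewrite /= ul.
move=> /hasP[e eJ /hasP[l _ /andP[ae /eqP ln]]].
by case: (avoid_point_compl eJ ae _ Jz); rewrite ln.
Qed.

End Soundness.

Lemma witnessP p x U J t g s i : rep_prod (delta_X nu) (delta_Sigma nu) p (x, U) ->
  witness p J t g s i ->
  delta_Delta nu (cell_name J) (cell J) /\ op_M (x, U) (cell J).
Proof.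
move=> [/= px pU] /and3P[aJ xg cov].
have Jx : cell J x by apply: all_avoid_cell aJ _; exact: in_nbhdP xg.
(* Validity of every code in [J] is part of the test [avoids]. *)
have Jv e : e \in CodeSeq.decode J -> valid_pair dq e.
  by move=> /(allP aJ)/and4P[].
have dJ := cell_nameP Jv Jx; split => //; split => //=.
  case: dJ => /delta_Sigma_open o1 /delta_Sigma_open o2; split => //.
  by rewrite -[cell J]setCK; exact: open_closedC.
exact: covered_sub cov.
Qed.

(** [J] collects the codes that exclude the balls not listed in [p], and [S] exceeds all search
    indices involved. Every collected code keeps [x] in the cell. *)
Lemma finite_family (p : baire) x (ns : seq nat) :
  (forall n, n \in ns -> (exists l, p l = n.+1) \/
     exists e t g, [/\ valid_pair dq e, f e x <> pt (csnd e),
       avoids e (cfst e) t g & nbhd_code g = n]) ->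
  exists J S, (forall e, e \in CodeSeq.decode J -> valid_pair dq e /\ f e x <> pt (csnd e)) /\
    forall s, S <= s ->
      all (fun n => has (fun l => p l == n.+1) (iota 0 s) || outside_ball J s n) ns.
Proof.
elim: ns => [|n ns IH] h; first by exists 0, 0.
have [J [S [hJ hS]]] := IH (fun n' nn => h n' (mem_behead (s := n :: ns) nn)).
case: (h n (mem_head _ _)) => [[l pl]|[e [t [g [ve fe ae gn]]]]].
  exists J, (maxn S l.+1); split => // s; rewrite geq_max => /andP[/hS Ss ls] /=.
  rewrite Ss andbT; apply/orP; left; apply/hasP; exists l; rewrite ?pl //.
  by rewrite mem_iota.
exists (wcode (e :: CodeSeq.decode J)), (maxn S (cpair t g).+1).
rewrite /outside_ball /wcode CodeSeq.codeK; split.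
  by move=> e'; rewrite in_cons => /orP[/eqP -> //|/hJ].
move=> s; rewrite geq_max => /andP[/hS Ss ls] /=; apply/andP; split.
  apply/orP; right; apply/orP; left; apply/hasP; exists (cpair t g).
    by rewrite mem_iota.
  by rewrite cfstK csndK ae gn eqxx.
apply: sub_all Ss => n' /orP[-> //|h']; apply/orP; right; apply/orP; right; exact: h'.
Qed.

Lemma witness_exists p x U : rep_prod (delta_X nu) (delta_Sigma nu) p (x, U) -> U x ->
  exists J t g s i, witness p J t g s i.
Proof.
move=> [/= px pU] Ux.
(* The balls that can be dealt with: those listed for U, and those excluded by a retraction that
   keeps [x] on the right side. *)
pose D := [set n | (exists l, bproj 1 p l = n.+1) \/
     exists e t g, [/\ valid_pair dq e, f e x <> pt (csnd e),
       avoids e (cfst e) t g & nbhd_code g = n]].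
have DX : [set: X] `<=` cover D (alpha nu).
  move=> y _; have [Uy|nUy] := pselect (U y).
    move: Uy; rewrite pU => -[l /= pl yl]; exists (bproj 1 p l).-1 => //.
    by left; exists l; rewrite prednK.
  (* Points outside U are caught by a separating pair, whose retraction omits its first point on a
     ball around [y]. *)
  have xy : x <> y by move=> xy; apply: nUy; rewrite -xy.
  have [e [ve fx fy]] := separating_pair nu_dense dist_codeP cFP Pf xy.
  have [r ry] := good_name_exists nu_dense y.
  have [T /(_ T (leqnn _))[K /(_ K (leqnn _)) hK]] := avoids_ex dist_codeP Pf ve ry fy.
  exists (nbhd_code (prefix_code r K)); last exact: nbhd_code_prefix.
  by right; exists e, T, (prefix_code r K).
have [ns nsD nsX] : exists2 ns : seq nat, {subset ns <= D} &
    [set: X] `<=` \bigcup_(n in [set` ns]) alpha nu n.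
  have [cX _] := pcP.
  (* [compact_cover] is stated for pointed spaces. *)
  pose pX := isPointed.Build X (nu 0).
  pose Y : ptopologicalType := HB.pack X pX.
  have : @compact Y [set: X] by exact: cX.
  rewrite compact_cover => /(_ nat D (alpha nu) (fun n _ => alpha_open nu n) DX).
  by move=> [D' D'D D'X]; exists (finmap.enum_fset D').
have [|J [S1 [hJ hS1]]] := @finite_family (bproj 1 p) x ns.
  by move=> n /nsD; rewrite inE.
have [r rx] := good_name_exists nu_dense x.
have [T /(_ T (leqnn _))[K /(_ K (leqnn _)) hK]] := all_avoid_ex rx hJ.
have [S2 hS2] := in_nbhd_ex px (nbhd_code_prefix (nu := nu) K rx).
(* [pc] lists all finite covers of X, in particular the subcover just found. *)
have [i _ ipc] : range pc (wcode ns) by case: pcP => _ ->; exists ns.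
exists J, T, (prefix_code r K), (maxn S1 S2), i; apply/and3P; split => //.
  by apply: hS2; exact: leq_maxr.
by rewrite /covered ipc /wcode CodeSeq.codeK; apply: hS1; exact: leq_maxl.
Qed.

Definition witness_code (p : baire) (m : nat) : bool :=
  witness p (cfst m) (cfst (csnd m)) (cfst (csnd (csnd m)))
    (cfst (csnd (csnd (csnd m)))) (csnd (csnd (csnd (csnd m)))).

Lemma rec_all_avoid J t g : recursive J -> recursive t -> recursive g ->
  recursive (fun p n => all_avoid (J p n) (t p n) (g p n)).
Proof.
move=> hJ ht hg; apply: (rec3 (h := fun _ J t g => nat_of_bool (all_avoid J t g))) => //.
rewrite /all_avoid; apply: (rec_all_word (B := fun p n e => _)); recursive.
by apply: rec_avoids => //; recursive.
Qed.

Lemma rec_witness_code m : recursive m -> recursive (fun p n => witness_code p (m p n)).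
Proof.
move=> hm; apply: (rec_subst (h := fun p m => nat_of_bool (witness_code p m))) => //.
rewrite /witness_code /witness /in_nbhd /covered /outside_ball /bproj; recursive.
- by apply: rec_all_avoid; recursive.
- by apply: rec_dist_code => //; recursive; apply: rec_lim_of; recursive.
- apply: (rec_all_word (B := fun p n e => _)); first by apply: rec_point => //; recursive.
  recursive; apply: (rec_has_word (B := fun p n e => _)); recursive.
    by apply: rec_avoids => //; recursive.
  by apply: rec_nbhd_code; recursive.
Qed.

Lemma rec_cell_name J i : recursive J -> recursive i ->
  recursive (fun p n => cell_name (J p n) (i p n)).
Proof.
move=> hJ hi; apply: (rec2 (h := fun _ => cell_name)) => //.
rewrite /cell_name /=; recursive.
- by apply: (rec_has_word (B := fun p n e => _)); recursive.
- by apply: rec_avoids => //; recursive.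
- by apply: rec_nbhd_code; recursive.
- by apply: rec_all_avoid; recursive.
- by apply: rec_nbhd_code; recursive.
Qed.

Lemma op_M_computable :
  computable_op (rep_prod (delta_X nu) (delta_Sigma nu)) (delta_Delta nu) dom_M
    (@op_M R X).
Proof.
(* Negated because [Mu] searches for the value 0. *)
have [cS hS] : recursive (fun p m => ~~ witness_code p (csnd m)).
  by recursive; apply: rec_witness_code; recursive.
have [cN hN] : recursive (fun p n => cell_name (cfst (cfst n)) (csnd n)).
  by apply: rec_cell_name; recursive.
(* The search runs on the constant input 0, so all output entries rely on the same least witness and
   describe the same cell. *)
pose cM := Comp cN (Pair (Comp (Mu cS) Zero) (Pair Fst Snd)).
exists (fun p q => forall n, eval p cM n (q n)); split; first by exists cM.
move=> p [x U] pxU [/= oU Ux].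
have ex : exists m, witness_code p m.
  have [J [t [g [s [i h]]]]] := witness_exists pxU Ux.
  exists (cpair J (cpair t (cpair g (cpair s i)))).
  by rewrite /witness_code !(cfstK, csndK).
case: (ex_minnP ex) => m hm mmin.
exists (cell_name (cfst m)); split; last by exists (cell (cfst m)); exact: witnessP pxU hm.
move=> n; exists (cpair m n); split; last first.
  by have := hN p (cpair m n); rewrite cfstK csndK.
exists m, n; split => //; last by exists (cfst n), (csnd n); rewrite cpairK.
exists 0; split => //; split.
  by have := hS p (cpair 0 m); rewrite csndK hm.
move=> i im; exists 0; have := hS p (cpair 0 i); rewrite csndK.
by case: (boolP (witness_code p i)) => // /mmin; rewrite leqNgt im.
Qed.

End Search.

(** * Zero-dimensionality and the conclusion *)

(** A realiser must answer on every name, so each pair of an open U and a point of U admits a clopen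
    set in between; hence the clopen sets form a basis. *)
Lemma op_M_zero_dim (R : realType) (X : metricType R) (nu : nat -> X) :
  dense (range nu) ->
  computable_op (rep_prod (delta_X nu) (delta_Sigma nu)) (delta_Delta nu) dom_M
    (@op_M R X) ->
  zero_dim X.
Proof.
move=> nud [F [_ hF]]; split; first by exists (nu 0).
  by exists (range nu); split => //; exact: card_image_le.
exists clopen; split => //; split; first by move=> W [].
move=> x V; rewrite nbhsE => -[U [oU Ux] UV].
have [r rx] := good_name_exists nud x.
have [u uU] := delta_Sigma_surj nud oU.
pose p n := if odd n then u n./2 else r n./2.
have p0 : bproj 0 p = r.
  by apply/funext => n; rewrite /bproj /p addn0 odd_double doubleK.
have p1 : bproj 1 p = u.
  by apply/funext => n; rewrite /bproj /p addn1 /= odd_double /= uphalf_double.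
have [q [_ [W [_ [cW Wx WU]]]]] : exists q, F p q /\
    exists W, delta_Delta nu q W /\ op_M (x, U) W.
  by apply: hF => //; split; rewrite /= ?p0 ?p1 //; exact: good_name_delta_X.
by exists W => // y /WU /UV.
Qed.

Theorem proposition8p5 (R : realType) (X : metricType R) (nu : nat -> X)
  (X_cms : computable_metric_space nu)
  (X_cover : has_computable_name (delta_cover nu) [set: X])
  (E_welldef : forall A : set X, dom_E A -> op_E A !=set0)
  (E_computable : computable_op
     (rep_meet (delta_range nu) (delta_dist_gt nu))
     (rep_fun (delta_X nu) (delta_X nu)) dom_E op_E) :
  zero_dim X /\
  computable_op (rep_prod (delta_X nu) (delta_Sigma nu)) (delta_Delta nu)
    dom_M op_M.
Proof.
have [nud [dq [dqc dqP]]] := X_cms; have [pc [pcc pcP]] := X_cover.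
have [F [[cF FcF] hF]] := E_computable.
(* The realiser of E is specialised to closed sets {x, y}, whose names are computed from Cauchy
   names of x and y. *)
have cFP p q x y : delta_X nu p x -> delta_X nu q y ->
    exists P, (forall n, eval (pair_name dq p q) cF n (P n)) /\
    exists f, rep_fun (delta_X nu) (delta_X nu) P f /\ op_E [set x; y] f.
  move=> px qy; have A := pair_nameP dqP px qy.
  have [|P [/FcF hP hf]] := hF _ _ A; last by exists P.
  by split; [have [[]] := A|exists x; left].
have [P [f [P_rec Pf]]] := retraction_family_exists dqP dqc cFP.
suff M : computable_op (rep_prod (delta_X nu) (delta_Sigma nu)) (delta_Delta nu)
    dom_M (@op_M R X) by split => //; exact: op_M_zero_dim M.
exact: (op_M_computable nud dqP dqc pcc pcP cFP P_rec Pf).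
Qed.
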